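(* Let $A=(A,\Delta,\epsilon,\Phi,\mathcal{R})$, with antipode $S$ and canonical elements $\alpha,\beta$, be a ribbon quasi-Hopf algebra over a field $K$, and let $F\in A\otimes A$ be any twistor (an invertible element with $(\epsilon\otimes 1)F=1=(1\otimes\epsilon)F$). Then the twisted quasi-triangular quasi-Hopf algebra $(A,\Delta_F,\epsilon,\Phi_F,\mathcal{R}_F)$, with antipode $S$ and canonical elements $\alpha_F,\beta_F$, is again a ribbon quasi-Hopf algebra.
   Context: Summation over repeated indices is understood; $m$ is the multiplication of $A$, $T(a\otimes b)=b\otimes a$, $\Delta^T=T\circ\Delta$, and for $X\in A\otimes A$, $X_{21}=T(X)$. Quasi-Hopf algebra: a unital associative $K$-algebra $A$ with algebra homomorphisms $\epsilon:A\to K$, $\Delta:A\to A\otimes A$, an invertible $\Phi\in A^{\otimes 3}$, an algebra anti-homomorphism $S:A\to A$ and elements $\alpha,\beta\in A$ such that, for all $a\in A$: $(1\otimes\Delta)\Delta(a)=\Phi^{-1}(\Delta\otimes1)\Delta(a)\Phi$; $(\Delta\otimes1\otimes1)\Phi\cdot(1\otimes1\otimes\Delta)\Phi=(\Phi\otimes1)\cdot(1\otimes\Delta\otimes1)\Phi\cdot(1\otimes\Phi)$; $(\epsilon\otimes1)\Delta=1=(1\otimes\epsilon)\Delta$; $(1\otimes\epsilon\otimes1)\Phi=1$; and, writing $\Delta(a)=\sum a_{(1)}\otimes a_{(2)}$, $\Phi=X_i\otimes Y_i\otimes Z_i$, $\Phi^{-1}=\bar X_i\otimes\bar Y_i\otimes\bar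 Z_i$: $\sum S(a_{(1)})\alpha a_{(2)}=\epsilon(a)\alpha$, $\sum a_{(1)}\beta S(a_{(2)})=\epsilon(a)\beta$, $\bar X_i\beta S(\bar Y_i)\alpha\bar Z_i=1$, $S(X_i)\alpha Y_i\beta S(Z_i)=1$. Quasi-triangular: there is an invertible $\mathcal{R}=a_\nu\otimes b_\nu\in A\otimes A$ with $\Delta^T(a)\mathcal{R}=\mathcal{R}\Delta(a)$ for all $a\in A$, $(\Delta\otimes1)\mathcal{R}=\Phi^{-1}_{231}\mathcal{R}_{13}\Phi_{132}\mathcal{R}_{23}\Phi^{-1}_{123}$, $(1\otimes\Delta)\mathcal{R}=\Phi_{312}\mathcal{R}_{13}\Phi^{-1}_{213}\mathcal{R}_{12}\Phi_{123}$. Here $\Phi_{123}=\Phi$, $\Phi_{132}=(1\otimes T)\Phi$, $\Phi_{312}=(T\otimes1)(1\otimes T)\Phi$, $\Phi^{-1}_{213}=(T\otimes1)\Phi^{-1}$, $\Phi^{-1}_{231}=(1\otimes T)(T\otimes1)\Phi^{-1}$. In a quasi-triangular quasi-Hopf algebra put $u=S(Y_i\beta S(Z_i))\,S(b_\nu)\,\alpha\, a_\nu X_i$; it is known that $u$ is invertible and $S^2(a)=uau^{-1}$ for all $a\in A$. Drinfeld twist: write $(\Phi^{-1}\otimes1)\cdot(\Delta\otimes1\otimes1)\Phi=A_i\otimes B_i\otimes C_i\otimes D_i$, $\gamma=S(B_i)\alpha C_i\otimes S(A_i)\alpha D_i$, and $\mathcal{F}=(S\otimes S)\Delta^T(X_i)\cdot\gamma\cdot\Delta(Y_i\beta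 S(Z_i))$, which is known to be an invertible element of $A\otimes A$. Ribbon quasi-Hopf algebra: a quasi-triangular quasi-Hopf algebra for which there is a central element $v\in A$ with (1) $v^2=uS(u)$; (2) $S(v)=v$; (3) $\epsilon(v)=1$; (4) $\Delta(uv^{-1})=\mathcal{F}^{-1}\cdot(S\otimes S)\mathcal{F}_{21}\cdot(uv^{-1}\otimes uv^{-1})$. Twisting: writing $F=f_i\otimes f^i$ and $F^{-1}=\bar f_i\otimes\bar f^i$, the twisted structure is $\Delta_F(a)=F\Delta(a)F^{-1}$, $\Phi_F=F_{12}\cdot(\Delta\otimes1)F\cdot\Phi\cdot(1\otimes\Delta)F^{-1}\cdot F_{23}^{-1}$, $\mathcal{R}_F=F_{21}\mathcal{R}F^{-1}$, $\alpha_F=S(\bar f_i)\alpha\bar f^i$, $\beta_F=f_i\beta S(f^i)$, with $\epsilon$ and $S$ unchanged; this is known to be again a quasi-triangular quasi-Hopf algebra. *)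

(* Defs.v *)
(* Classical logic is used for quotients by Prop-valued relations, for Zorn's lemma
   and for choosing inverses. *)
From HB Require Import structures.
From mathcomp Require Import all_boot all_order all_algebra.
From mathcomp Require Import boolp classical_sets.

Set Implicit Arguments.
Unset Strict Implicit.
Unset Printing Implicit Defensive.

Import GRing.Theory.
Local Open Scope ring_scope.
Local Open Scope quotient_scope.

Definition bilinear_map (K : fieldType) (U V W : lmodType K)
    (f : U -> V -> W) : Prop :=
  (forall v, linear (fun u => f u v)) /\ (forall u, linear (f u)).

(** * Tensor product of vector spaces *)

Section TensorProduct.
Variables (K : fieldType) (U V : lmodType K).

(* A sequence [:: (u1, v1); ..; (un, vn)] stands for the formal sum of the
   ui (x) vi. *)
Inductive tensor_eq : seq (U * V) -> seq (U * V) -> Prop :=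
| tensor_eq_refl s : tensor_eq s s
| tensor_eq_sym s t : tensor_eq s t -> tensor_eq t s
| tensor_eq_trans s t r : tensor_eq s t -> tensor_eq t r -> tensor_eq s r
| tensor_eq_cat s s' t t' :
    tensor_eq s s' -> tensor_eq t t' -> tensor_eq (s ++ t) (s' ++ t')
| tensor_eq_catC s t : tensor_eq (s ++ t) (t ++ s)
| tensor_eq_addl u u' v :
    tensor_eq [:: (u + u', v)] [:: (u, v); (u', v)]
| tensor_eq_addr u v v' :
    tensor_eq [:: (u, v + v')] [:: (u, v); (u, v')]
| tensor_eq_scale k u v : tensor_eq [:: (k *: u, v)] [:: (u, k *: v)]
| tensor_eq_zero v : tensor_eq [:: (0, v)] [::].

Definition tensor_rel (s t : seq (U * V)) : bool := `[< tensor_eq s t >].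

Lemma tensor_rel_refl : reflexive tensor_rel.
Proof. by move=> s; apply/asboolP; exact: tensor_eq_refl. Qed.

Lemma tensor_rel_sym : symmetric tensor_rel.
Proof. by move=> s t; apply/asboolP/asboolP; exact: tensor_eq_sym. Qed.

Lemma tensor_rel_trans : transitive tensor_rel.
Proof.
by move=> t s r /asboolP st /asboolP tr; apply/asboolP; apply: tensor_eq_trans tr.
Qed.

Canonical tensor_equiv :=
  EquivRel tensor_rel tensor_rel_refl tensor_rel_sym tensor_rel_trans.

Definition tensor := {eq_quot tensor_rel}.
HB.instance Definition _ : EqQuotient _ tensor_rel tensor :=
  EqQuotient.on tensor.
HB.instance Definition _ := Choice.on tensor.

Lemma pi_tensorP s t : \pi_tensor s = \pi_tensor t <-> tensor_eq s t.
Proof.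
by split=> [/eqP|st]; last apply/eqP; rewrite eqmodE; [move/asboolP|apply/asboolP].
Qed.

Lemma repr_pi_tensor s : tensor_eq (repr (\pi_tensor s)) s.
Proof. by apply/pi_tensorP; rewrite reprK. Qed.

Definition tensor_pure (u : U) (v : V) : tensor := \pi_tensor [:: (u, v)].

Definition tensor_zero : tensor := \pi_tensor [::].
Definition tensor_add (x y : tensor) : tensor := \pi_tensor (repr x ++ repr y).

Definition scale_terms (k : K) (s : seq (U * V)) := [seq (k *: p.1, p.2) | p <- s].
Definition tensor_scale (k : K) (x : tensor) : tensor :=
  \pi_tensor (scale_terms k (repr x)).
Definition tensor_opp (x : tensor) : tensor := tensor_scale (-1) x.

Lemma scale_terms_eq k s t :
  tensor_eq s t -> tensor_eq (scale_terms k s) (scale_terms k t).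
Proof.
elim=> {s t} [s|s t _|s t r _ + _|s s' t t' _ + _||||/=|v] /=.
- exact: tensor_eq_refl.
- exact: tensor_eq_sym.
- exact: tensor_eq_trans.
- by rewrite /scale_terms !map_cat; exact: tensor_eq_cat.
- by move=> s t; rewrite /scale_terms !map_cat; exact: tensor_eq_catC.
- by move=> u u' v; rewrite scalerDr; exact: tensor_eq_addl.
- by move=> u v v'; exact: tensor_eq_addr.
- by move=> l u v; rewrite scalerA mulrC -scalerA; exact: tensor_eq_scale.
- by rewrite scaler0; exact: tensor_eq_zero.
Qed.

Lemma tensor_addE s t : tensor_add (\pi_tensor s) (\pi_tensor t) = \pi_tensor (s ++ t).
Proof. by apply/pi_tensorP; apply: tensor_eq_cat; exact: repr_pi_tensor. Qed.

Lemma tensor_scaleE k s : tensor_scale k (\pi_tensor s) = \pi_tensor (scale_terms k s).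
Proof. by apply/pi_tensorP; apply: scale_terms_eq; exact: repr_pi_tensor. Qed.

Fact tensor_addA : associative tensor_add.
Proof.
move=> x y z; elim/quotW: x => s; elim/quotW: y => t; elim/quotW: z => r.
by rewrite (tensor_addE t r) (tensor_addE s t)
  (tensor_addE s (t ++ r)) (tensor_addE (s ++ t) r) catA.
Qed.

Fact tensor_addC : commutative tensor_add.
Proof.
move=> x y; elim/quotW: x => s; elim/quotW: y => t.
rewrite (tensor_addE s t) (tensor_addE t s).
by apply/pi_tensorP; exact: tensor_eq_catC.
Qed.

Fact tensor_add0 : left_id tensor_zero tensor_add.
Proof. by move=> x; elim/quotW: x => s; rewrite /tensor_zero tensor_addE. Qed.

Fact tensor_scaleDl x : {morph tensor_scale^~ x : k l / k + l >-> tensor_add k l}.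
Proof.
move=> k l /=; elim/quotW: x => s; rewrite !tensor_scaleE tensor_addE.
apply/pi_tensorP; elim: s => [|[u v] s IHs] /=; first exact: tensor_eq_refl.
rewrite scalerDl.
apply: (@tensor_eq_trans _
   ([:: (k *: u, v); (l *: u, v)] ++ (scale_terms k s ++ scale_terms l s))).
  exact: tensor_eq_cat (tensor_eq_addl _ _ _) IHs.
apply: (tensor_eq_cat (tensor_eq_refl [:: _])).
have := tensor_eq_cat (tensor_eq_catC [:: (l *: u, v)] (scale_terms k s))
  (tensor_eq_refl (scale_terms l s)).
by rewrite -!catA.
Qed.

Fact tensor_scale0 x : tensor_scale 0 x = tensor_zero.
Proof.
elim/quotW: x => s; rewrite tensor_scaleE; apply/pi_tensorP.
elim: s => [|[u v] s IHs] /=; first exact: tensor_eq_refl.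
by rewrite scale0r; apply: (@tensor_eq_cat [:: _] [::] _ [::]) => //;
   exact: tensor_eq_zero.
Qed.

Fact tensor_scale1 : left_id 1 tensor_scale.
Proof.
move=> x; elim/quotW: x => s; rewrite tensor_scaleE; congr (\pi_tensor _).
by rewrite -[RHS]map_id; apply: eq_map => -[u v] /=; rewrite scale1r.
Qed.

Fact tensor_addN : left_inverse tensor_zero tensor_opp tensor_add.
Proof.
move=> x; rewrite -[X in tensor_add _ X]tensor_scale1 -tensor_scaleDl.
by rewrite addNr tensor_scale0.
Qed.

HB.instance Definition _ := GRing.isZmodule.Build tensor
  tensor_addA tensor_addC tensor_add0 tensor_addN.

Lemma pi_tensor_cat s t : \pi_tensor (s ++ t) = \pi_tensor s + \pi_tensor t.
Proof. by rewrite [RHS]tensor_addE. Qed.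

Fact tensor_scaleA k l x :
  tensor_scale k (tensor_scale l x) = tensor_scale (k * l) x.
Proof.
elim/quotW: x => s; rewrite (tensor_scaleE l s) !tensor_scaleE; congr (\pi_tensor _).
by rewrite /scale_terms -map_comp; apply: eq_map => -[u v] /=; rewrite scalerA.
Qed.

Fact tensor_scaleDr : right_distributive tensor_scale +%R.
Proof.
move=> k x y; elim/quotW: x => s; elim/quotW: y => t.
by rewrite -pi_tensor_cat !tensor_scaleE -pi_tensor_cat /scale_terms map_cat.
Qed.

HB.instance Definition _ := GRing.Zmodule_isLmodule.Build K tensor
  tensor_scaleA tensor_scale1 tensor_scaleDr tensor_scaleDl.

Lemma pi_tensorE s : \pi_tensor s = \sum_(p <- s) tensor_pure p.1 p.2.
Proof.
elim: s => [|[u v] s IHs]; first by rewrite big_nil.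
by rewrite big_cons -IHs -cat1s pi_tensor_cat.
Qed.

Lemma tensor_pure_bilinear : bilinear_map tensor_pure.
Proof.
split=> [v|u] k a b.
  transitivity (tensor_pure (k *: a) v + tensor_pure b v).
    by rewrite -pi_tensor_cat; apply/pi_tensorP; exact: tensor_eq_addl.
  by congr (_ + _); rewrite [RHS]tensor_scaleE.
transitivity (tensor_pure u (k *: a) + tensor_pure u b).
  by rewrite -pi_tensor_cat; apply/pi_tensorP; exact: tensor_eq_addr.
congr (_ + _); rewrite [RHS]tensor_scaleE /=.
by apply/pi_tensorP; apply: tensor_eq_sym; exact: tensor_eq_scale.
Qed.

Lemma tensor_sum (x : tensor) : x = \sum_(p <- repr x) tensor_pure p.1 p.2.
Proof. by rewrite -pi_tensorE reprK. Qed.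

Lemma tensor_ind (P : tensor -> Prop) :
  P 0 -> (forall x y, P x -> P y -> P (x + y)) ->
  (forall u v, P (tensor_pure u v)) -> forall x, P x.
Proof.
move=> P0 PD Pp x; rewrite [x]tensor_sum.
by apply: (big_ind P) => // p _; exact: Pp.
Qed.

End TensorProduct.

Arguments tensor {K} U V.
Notation "u \ox v" := (tensor_pure u v)
  (at level 40, left associativity) : ring_scope.

(* The sum of the f ui vi over a chosen expression x = sum_i ui (x) vi; when f is
   bilinear it does not depend on that expression (tensor_liftE). *)
Definition tensor_lift (K : fieldType) (U V : lmodType K) (W : nmodType)
    (f : U -> V -> W) (x : tensor U V) : W :=
  \sum_(p <- repr x) f p.1 p.2.

Notation "\tsum_ ( u \ox v <- x ) F" := (tensor_lift (fun u v => F) x)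
  (at level 41, u name, v name, x at level 200, F at level 41,
   format "\tsum_ ( u  \ox  v  <-  x )  F") : ring_scope.

Section Lift.
Variables (K : fieldType) (U V W : lmodType K) (f : U -> V -> W).
Hypothesis fbil : bilinear_map f.

Let fl v : linear (fun u => f u v). Proof. exact: fbil.1. Qed.
Let fr u : linear (f u). Proof. exact: fbil.2. Qed.

Let f0l v : f 0 v = 0.
Proof. by have := fl v (-1) 0 0; rewrite !scaleN1r !addNr. Qed.
Let f0r u : f u 0 = 0.
Proof. by have := fr u (-1) 0 0; rewrite !scaleN1r !addNr. Qed.
Let fDl v u u' : f (u + u') v = f u v + f u' v.
Proof. by have := fl v 1 u u'; rewrite !scale1r. Qed.
Let fDr u v v' : f u (v + v') = f u v + f u v'.
Proof. by have := fr u 1 v v'; rewrite !scale1r. Qed.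
Let fZl v k u : f (k *: u) v = k *: f u v.
Proof. by have := fl v k u 0; rewrite f0l !addr0. Qed.
Let fZr u k v : f u (k *: v) = k *: f u v.
Proof. by have := fr u k v 0; rewrite f0r !addr0. Qed.

Lemma tensor_lift_pi s :
  tensor_lift f (\pi_(tensor U V) s) = \sum_(p <- s) f p.1 p.2.
Proof.
have : tensor_eq (repr (\pi_(tensor U V) s)) s by exact: repr_pi_tensor.
rewrite /tensor_lift; move: (repr _) => t.
elim=> {s t} [//|s t _ -> //|s t r _ -> _ -> //|s s' t t' _ ss' _ tt'
  |s t|u u' v|u v v'|k u v|v]; rewrite ?big_cat ?big_cons ?big_nil /= ?addr0 //.
- by rewrite ss' tt'.
- by rewrite addrC.
- by rewrite fZl fZr.
Qed.

Lemma tensor_liftE u v : tensor_lift f (u \ox v) = f u v.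
Proof. by rewrite tensor_lift_pi big_seq1. Qed.

Lemma tensor_lift_linear : linear (tensor_lift f).
Proof.
move=> k x y; elim/quotW: x => s; elim/quotW: y => t.
have -> : k *: (\pi s : tensor U V) + \pi t
        = \pi_(tensor U V) (scale_terms k s ++ t).
  by rewrite pi_tensor_cat; congr (_ + _); exact: tensor_scaleE.
rewrite !tensor_lift_pi big_cat /= big_map /= scaler_sumr; congr (_ + _).
by apply: eq_bigr => p _; rewrite fZl.
Qed.

End Lift.

Lemma tensor_ext (K : fieldType) (U V W : lmodType K)
    (f g : {linear tensor U V -> W}) :
  (forall u v, f (u \ox v) = g (u \ox v)) -> f =1 g.
Proof.
move=> fg x; elim/tensor_ind: x => [|x y fx fy|//]; first by rewrite !linear0.
by rewrite !linearD fx fy.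
Qed.

Section PureTheory.
Variables (K : fieldType) (U V : lmodType K).
Implicit Types (u : U) (v : V).

Lemma oxDl u u' v : (u + u') \ox v = u \ox v + u' \ox v.
Proof. by have := (tensor_pure_bilinear U V).1 v 1 u u'; rewrite !scale1r. Qed.
Lemma oxDr u v v' : u \ox (v + v') = u \ox v + u \ox v'.
Proof. by have := (tensor_pure_bilinear U V).2 u 1 v v'; rewrite !scale1r. Qed.
Lemma ox0l v : (0 : U) \ox v = 0.
Proof. by apply: (addIr (0 \ox v)); rewrite -oxDl !add0r. Qed.
Lemma ox0r u : u \ox (0 : V) = 0.
Proof. by apply: (addIr (u \ox 0)); rewrite -oxDr !add0r. Qed.
Lemma oxZl k u v : (k *: u) \ox v = k *: (u \ox v).
Proof.
by have := (tensor_pure_bilinear U V).1 v k u 0; rewrite ox0l !addr0.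
Qed.
Lemma oxZr k u v : u \ox (k *: v) = k *: (u \ox v).
Proof.
by have := (tensor_pure_bilinear U V).2 u k v 0; rewrite ox0r !addr0.
Qed.
End PureTheory.

(** ** Linear maps between tensor products *)

Definition tensor_map (K : fieldType) (U V U' V' : lmodType K)
    (f : U -> U') (g : V -> V') (x : tensor U V) : tensor U' V' :=
  \tsum_(u \ox v <- x) f u \ox g v.

Section TensorMap.
Variables (K : fieldType) (U V U' V' : lmodType K).
Variables (f : {linear U -> U'}) (g : {linear V -> V'}).

Fact tensor_map_bilinear : bilinear_map (fun u v => f u \ox g v).
Proof.
by split=> [v|u] k a b; rewrite linearP ?oxDl ?oxDr ?oxZl ?oxZr.
Qed.

Lemma tensor_mapE u v : tensor_map f g (u \ox v) = f u \ox g v.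
Proof. exact: tensor_liftE tensor_map_bilinear u v. Qed.

HB.instance Definition _ := GRing.isLinear.Build K (tensor U V) (tensor U' V')
  *:%R (tensor_map f g) (tensor_lift_linear tensor_map_bilinear).

End TensorMap.

Section Flip.
Variables (K : fieldType) (U V : lmodType K).

Definition tensor_flip (x : tensor U V) : tensor V U :=
  \tsum_(u \ox v <- x) v \ox u.

Fact tensor_flip_bilinear :
  bilinear_map (fun (u : U) (v : V) => v \ox u).
Proof. by split=> [v|u] k a b; rewrite ?oxDl ?oxDr ?oxZl ?oxZr. Qed.

Lemma tensor_flipE u v : tensor_flip (u \ox v) = v \ox u.
Proof. exact: tensor_liftE tensor_flip_bilinear u v. Qed.

HB.instance Definition _ := GRing.isLinear.Build K (tensor U V) (tensor V U)
  *:%R tensor_flip (tensor_lift_linear tensor_flip_bilinear).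

End Flip.

Section Associator.
Variables (K : fieldType) (U V W : lmodType K).

Definition tensor_assoc (x : tensor (tensor U V) W) : tensor U (tensor V W) :=
  \tsum_(y \ox w <- x) \tsum_(u \ox v <- y) u \ox (v \ox w).

Definition tensor_assocV (x : tensor U (tensor V W)) : tensor (tensor U V) W :=
  \tsum_(u \ox y <- x) \tsum_(v \ox w <- y) u \ox v \ox w.

Let in1 (w : W) : bilinear_map (fun (u : U) (v : V) => u \ox (v \ox w)).
Proof. by split=> [v|u] k a b; rewrite ?oxDl ?oxDr ?oxZl ?oxZr ?oxDr ?oxZr. Qed.

Let in2 (u : U) : bilinear_map (fun (v : V) (w : W) => u \ox v \ox w).
Proof. by split=> [w|v] k a b; rewrite ?oxDl ?oxDr ?oxZl ?oxZr ?oxDl ?oxZl. Qed.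

Fact tensor_assoc_bilinear : bilinear_map (fun (y : tensor U V) (w : W) =>
  \tsum_(u \ox v <- y) u \ox (v \ox w)).
Proof.
split=> [w|y] k a b; first exact: (tensor_lift_linear (in1 w)).
elim/quotW: y => s; rewrite !tensor_lift_pi //= scaler_sumr -big_split /=.
by apply: eq_bigr => p _; rewrite !oxDr !oxZr.
Qed.

Fact tensor_assocV_bilinear : bilinear_map (fun (u : U) (y : tensor V W) =>
  \tsum_(v \ox w <- y) u \ox v \ox w).
Proof.
split=> [y|u] k a b; last exact: (tensor_lift_linear (in2 u)).
elim/quotW: y => s; rewrite !tensor_lift_pi //= scaler_sumr -big_split /=.
by apply: eq_bigr => p _; rewrite !oxDl !oxZl.
Qed.

Lemma tensor_assocE u v w : tensor_assoc (u \ox v \ox w) = u \ox (v \ox w).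
Proof.
rewrite /tensor_assoc (tensor_liftE tensor_assoc_bilinear).
exact: tensor_liftE (in1 w) u v.
Qed.

Lemma tensor_assocVE u v w : tensor_assocV (u \ox (v \ox w)) = u \ox v \ox w.
Proof.
rewrite /tensor_assocV (tensor_liftE tensor_assocV_bilinear).
exact: tensor_liftE (in2 u) v w.
Qed.

HB.instance Definition _ := GRing.isLinear.Build K
  (tensor (tensor U V) W) (tensor U (tensor V W))
  *:%R tensor_assoc (tensor_lift_linear tensor_assoc_bilinear).
HB.instance Definition _ := GRing.isLinear.Build K
  (tensor U (tensor V W)) (tensor (tensor U V) W)
  *:%R tensor_assocV (tensor_lift_linear tensor_assocV_bilinear).

End Associator.

(** * Tensor product of algebras *)

(* The existence of this functional, hence 1 (x) 1 != 0, is the only point where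
   the base ring has to be a field. *)
Lemma ex_functional (K : fieldType) (V : lmodType K) (e : V) :
  e != 0 -> exists f : {scalar V}, f e = 1.
Proof.
move=> e0.
pose closed (W : set V) := forall (k : K) u v, W u -> W v -> W (k *: u + v).
pose P (W : set V) := closed W /\ ~ W e.
have [W [[Wc We] Wmax]] : exists W, P W /\ (forall B, (W `<` B)%classic -> ~ P B).
  apply: Zorn_bigcup => F FP Ftot; split; last by move=> [X FX]; exact: (FP X FX).2.
  move=> k u v [X FX Xu] [Y FY Yv].
  case: (Ftot X Y FX FY) => [XY|YX].
    by exists Y => //; apply: (FP Y FY).1 => //; exact: XY.
  by exists X => //; apply: (FP X FX).1 => //; exact: YX.
have W0 : W 0.
  apply: contrapT => W0; apply: (Wmax (W `|` [set 0])%classic).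
    split; first by move=> x Wx; left.
    by move=> /(_ 0 (or_intror erefl)).
  split; last by case=> // /eqP; rewrite (negbTE e0).
  move=> k u v [Wu|->] [Wv|->].
  - by left; exact: Wc.
  - by case: W0; rewrite -(addNr u) -scaleN1r; exact: Wc.
  - by left; rewrite scaler0 add0r.
  - by right; rewrite scaler0 addr0.
have WZ k u : W u -> W (k *: u) by move=> Wu; rewrite -[_ *: _]addr0; exact: Wc.
have WB u v : W u -> W v -> W (u - v).
  by move=> Wu Wv; rewrite addrC -scaleN1r; exact: Wc.
have Wuniq x k l : W (x - k *: e) -> W (x - l *: e) -> k = l.
  move=> Wk Wl; apply/eqP; rewrite -subr_eq0; apply/negP => /negP kl; apply: We.
  have := WZ (k - l)^-1 _ (WB _ _ Wl Wk).
  rewrite opprB [x - l *: e + _]addrC addrA subrK -scalerBl scalerA mulVf ?scale1r //.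
have Wex x : exists k, W (x - k *: e).
  have [Wx|Wx] := pselect (W x); first by exists 0; rewrite scale0r subr0.
  pose B := [set y | exists k w, W w /\ y = k *: x + w]%classic.
  have BE : B e.
    apply: contrapT => Be; apply: (Wmax B).
      split; first by move=> w Ww; exists 0, w; rewrite scale0r add0r.
      by move=> /(_ x) BW; apply/Wx/BW; exists 1, 0; rewrite scale1r addr0.
    split=> // k _ _ [l [w [Ww ->]]] [m [z [Wz ->]]].
    exists (k * l + m), (k *: w + z); split; first exact: Wc.
    by rewrite scalerDr scalerDl scalerA addrACA.
  have [k [w [Ww ew]]] := BE.
  have k0 : k != 0.
    by apply/eqP => k0; apply: We; rewrite ew k0 scale0r add0r.
  exists k^-1; have := WZ (- k^-1) w Ww; congr W.
  rewrite ew scalerDr scalerA mulVf // scale1r opprD addrA subrr add0r.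
  by rewrite scaleNr.
pose f x := projT1 (cid (Wex x)).
have fW x : W (x - f x *: e) by rewrite /f; case: cid.
have flin : scalar f.
  move=> k u v; apply: (Wuniq (k *: u + v)) => //.
  have := Wc k _ _ (fW u) (fW v); congr W.
  by rewrite scalerBr scalerDl opprD scalerA addrACA.
pose F : {scalar V} := HB.pack f (GRing.isLinear.Build K V K _ f flin).
by exists F; apply: (Wuniq e) => //; rewrite /= scale1r subrr.
Qed.

Lemma tensor_pure_neq0 (K : fieldType) (U V : lmodType K) (u : U) (v : V) :
  u != 0 -> v != 0 -> u \ox v != 0.
Proof.
move=> /ex_functional[f fu] /ex_functional[g gv]; apply/eqP => uv0.
have fg : bilinear_map (fun (x : U) (y : V) => f x * g y : K^o).
  split=> [y|x] k a b; rewrite linearP.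
    by rewrite mulrDl -mulrA.
  by rewrite mulrDr mulrCA.
have := tensor_lift_linear fg (-1) 0 0.
rewrite scaleN1r scaleN1r !addNr -uv0 (tensor_liftE fg) fu gv mul1r => /eqP.
by rewrite oner_eq0.
Qed.

Section TensorAlgebra.
Variables (K : fieldType) (A B : algType K).
Implicit Types x y z : tensor A B.

Definition tensor_one : tensor A B := 1 \ox 1.

Definition tensor_mul x y : tensor A B :=
  \tsum_(a \ox b <- x) \tsum_(c \ox d <- y) (a * c) \ox (b * d).

Let mulr_bil (a : A) (b : B) :
  bilinear_map (fun (c : A) (d : B) => (a * c) \ox (b * d)).
Proof.
by split=> [d|c] k u v;
   rewrite mulrDr ?oxDl ?oxDr -scalerAr ?oxZl ?oxZr.
Qed.

Let mull_bil y : bilinear_map (fun (a : A) (b : B) =>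
  \tsum_(c \ox d <- y) (a * c) \ox (b * d)).
Proof.
split=> [b|a] k u v; elim/quotW: y => s; rewrite !tensor_lift_pi //=;
  rewrite scaler_sumr -big_split /=; apply: eq_bigr => p _;
  by rewrite mulrDl ?oxDl ?oxDr -scalerAl ?oxZl ?oxZr.
Qed.

Fact tensor_mulPl y : linear (tensor_mul^~ y).
Proof. exact: tensor_lift_linear (mull_bil y). Qed.

Fact tensor_mulPr x : linear (tensor_mul x).
Proof.
move=> k y z; rewrite /tensor_mul /tensor_lift scaler_sumr -big_split /=.
by apply: eq_bigr => p _; exact: (tensor_lift_linear (mulr_bil p.1 p.2)).
Qed.

Fact tensor_mul_pure (a c : A) (b d : B) :
  tensor_mul (a \ox b) (c \ox d) = (a * c) \ox (b * d).
Proof.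
by rewrite /tensor_mul (tensor_liftE (mull_bil _)) (tensor_liftE (mulr_bil a b)).
Qed.

Fact tensor_mulDl : left_distributive tensor_mul +%R.
Proof. by move=> x y z; have := tensor_mulPl z 1 x y; rewrite !scale1r. Qed.

Fact tensor_mulDr : right_distributive tensor_mul +%R.
Proof. by move=> x y z; have := tensor_mulPr x 1 y z; rewrite !scale1r. Qed.

Fact tensor_mul0l x : tensor_mul 0 x = 0.
Proof. by apply: (addIr (tensor_mul 0 x)); rewrite -tensor_mulDl !add0r. Qed.

Fact tensor_mul0r x : tensor_mul x 0 = 0.
Proof. by apply: (addIr (tensor_mul x 0)); rewrite -tensor_mulDr !add0r. Qed.

Fact tensor_mulA : associative tensor_mul.
Proof.
move=> x y z.
elim/tensor_ind: x => [|x x' IHx IHx'|a b]; first by rewrite !tensor_mul0l.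
  by rewrite !tensor_mulDl IHx IHx'.
elim/tensor_ind: y => [|y y' IHy IHy'|c d].
- by rewrite tensor_mul0l !tensor_mul0r tensor_mul0l.
- by rewrite tensor_mulDl !tensor_mulDr tensor_mulDl IHy IHy'.
elim/tensor_ind: z => [|z z' IHz IHz'|a' b']; first by rewrite !tensor_mul0r.
  by rewrite !tensor_mulDr IHz IHz'.
by rewrite !tensor_mul_pure !mulrA.
Qed.

Fact tensor_mul1l : left_id tensor_one tensor_mul.
Proof.
move=> x; elim/tensor_ind: x => [|x x' IHx IHx'|a b].
- exact: tensor_mul0r.
- by rewrite tensor_mulDr IHx IHx'.
- by rewrite tensor_mul_pure !mul1r.
Qed.

Fact tensor_mul1r : right_id tensor_one tensor_mul.
Proof.
move=> x; elim/tensor_ind: x => [|x x' IHx IHx'|a b].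
- exact: tensor_mul0l.
- by rewrite tensor_mulDl IHx IHx'.
- by rewrite tensor_mul_pure !mulr1.
Qed.

Fact tensor_one_neq0 : tensor_one != 0.
Proof. by apply: tensor_pure_neq0; exact: oner_neq0. Qed.

HB.instance Definition _ := GRing.Zmodule_isNzRing.Build (tensor A B)
  tensor_mulA tensor_mul1l tensor_mul1r tensor_mulDl tensor_mulDr
  tensor_one_neq0.

Fact tensor_scalerAl (k : K) x y : k *: (x * y) = (k *: x) * y.
Proof.
have := tensor_mulPl y k x 0.
by rewrite tensor_mul0l !addr0 => <-.
Qed.

HB.instance Definition _ :=
  GRing.Lmodule_isLalgebra.Build K (tensor A B) tensor_scalerAl.

Fact tensor_scalerAr (k : K) x y : k *: (x * y) = x * (k *: y).
Proof.
have := tensor_mulPr x k y 0.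
by rewrite tensor_mul0r !addr0 => <-.
Qed.

HB.instance Definition _ :=
  GRing.Lalgebra_isAlgebra.Build K (tensor A B) tensor_scalerAr.

Lemma oxM (a c : A) (b d : B) : (a \ox b) * (c \ox d) = (a * c) \ox (b * d).
Proof. exact: tensor_mul_pure. Qed.

Lemma ox11 : (1 : A) \ox (1 : B) = 1.
Proof. by []. Qed.

End TensorAlgebra.

(** * Threefold and fourfold tensors, bracketed to the left *)

Notation tensor2 A := (tensor A A).
Notation tensor3 A := (tensor (tensor A A) A).
Notation tensor4 A := (tensor (tensor (tensor A A) A) A).

Section TensorPowers.
Variables (K : fieldType) (A : algType K).

Definition tensor_lift3 (W : nmodType) (f : A -> A -> A -> W)
    (t : tensor3 A) : W :=
  \tsum_(p \ox z <- t) \tsum_(x \ox y <- p) f x y z.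

Definition tensor_lift4 (W : nmodType) (f : A -> A -> A -> A -> W)
    (t : tensor4 A) : W :=
  \tsum_(p \ox d <- t) tensor_lift3 (fun a b c => f a b c d) p.

(* T (x) 1 and 1 (x) T on A (x) A (x) A. *)
Definition T12 (t : tensor3 A) : tensor3 A :=
  tensor_map (@tensor_flip K A A) idfun t.
Definition T23 (t : tensor3 A) : tensor3 A :=
  tensor_assocV (tensor_map idfun (@tensor_flip K A A) (tensor_assoc t)).

HB.instance Definition _ :=
  GRing.Linear.copy T12 (tensor_map (@tensor_flip K A A) idfun).
HB.instance Definition _ := GRing.Linear.copy T23
  (@tensor_assocV K A A A \o tensor_map idfun (@tensor_flip K A A)
     \o @tensor_assoc K A A A).

Lemma T12E a b c : T12 (a \ox b \ox c) = b \ox a \ox c.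
Proof. by rewrite /T12 tensor_mapE /= tensor_flipE. Qed.

Lemma T23E a b c : T23 (a \ox b \ox c) = a \ox c \ox b.
Proof.
by rewrite /T23 tensor_assocE tensor_mapE /= tensor_flipE tensor_assocVE.
Qed.

Definition leg12 (x : tensor2 A) : tensor3 A := x \ox 1.
Definition leg23 (x : tensor2 A) : tensor3 A := tensor_assocV (1 \ox x).
Definition leg13 (x : tensor2 A) : tensor3 A := T23 (leg12 x).
Definition leg123 (t : tensor3 A) : tensor4 A := t \ox 1.
Definition leg234 (t : tensor3 A) : tensor4 A :=
  tensor_map (@tensor_assocV K A A A) idfun (tensor_assocV (1 \ox t)).

Lemma leg23E a b : leg23 (a \ox b) = 1 \ox a \ox b.
Proof. by rewrite /leg23 tensor_assocVE. Qed.

Lemma leg13E a b : leg13 (a \ox b) = a \ox 1 \ox b.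
Proof. by rewrite /leg13 /leg12 T23E. Qed.

Lemma leg234E a b c : leg234 (a \ox b \ox c) = 1 \ox a \ox b \ox c.
Proof. by rewrite /leg234 tensor_assocVE tensor_mapE /= tensor_assocVE. Qed.

Variable D : {linear A -> tensor2 A}.

(* D (x) 1 and 1 (x) D on A (x) A. *)
Definition map_D1 (x : tensor2 A) : tensor3 A := tensor_map D idfun x.
Definition map_1D (x : tensor2 A) : tensor3 A :=
  tensor_assocV (tensor_map idfun D x).

HB.instance Definition _ := GRing.Linear.copy map_D1 (tensor_map D idfun).
HB.instance Definition _ :=
  GRing.Linear.copy map_1D (@tensor_assocV K A A A \o tensor_map idfun D).

(* D (x) 1 (x) 1, 1 (x) D (x) 1 and 1 (x) 1 (x) D on A (x) A (x) A. *)
Definition map_D11 (t : tensor3 A) : tensor4 A := tensor_map map_D1 idfun t.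
Definition map_1D1 (t : tensor3 A) : tensor4 A := tensor_map map_1D idfun t.
Definition map_11D (t : tensor3 A) : tensor4 A :=
  tensor_assocV (tensor_map idfun D t).

Variable eps : {scalar A}.

(* eps (x) 1, 1 (x) eps and 1 (x) eps (x) 1, where K (x) A and A (x) K are
   identified with A. *)
Definition map_e1 (x : tensor2 A) : A := \tsum_(a \ox b <- x) eps a *: b.
Definition map_1e (x : tensor2 A) : A := \tsum_(a \ox b <- x) eps b *: a.
Fact map_e1_bilinear : bilinear_map (fun a b : A => eps a *: b).
Proof.
split=> [b|a] k u v; first by rewrite linearP scalerDl -scalerA.
by rewrite scalerDr !scalerA mulrC.
Qed.

Fact map_1e_bilinear : bilinear_map (fun a b : A => eps b *: a).
Proof.
split=> [b|a] k u v; first by rewrite scalerDr !scalerA mulrC.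
by rewrite linearP scalerDl -scalerA.
Qed.

Lemma map_e1E a b : map_e1 (a \ox b) = eps a *: b.
Proof. exact: tensor_liftE map_e1_bilinear a b. Qed.

Lemma map_1eE a b : map_1e (a \ox b) = eps b *: a.
Proof. exact: tensor_liftE map_1e_bilinear a b. Qed.

HB.instance Definition _ := GRing.isLinear.Build K (tensor A A) A *:%R map_e1
  (tensor_lift_linear map_e1_bilinear).
HB.instance Definition _ := GRing.isLinear.Build K (tensor A A) A *:%R map_1e
  (tensor_lift_linear map_1e_bilinear).

Definition map_1e1 (t : tensor3 A) : tensor2 A := tensor_map map_1e idfun t.

End TensorPowers.

Notation "\tsum_ ( x \ox y \ox z <- t ) F" :=
  (tensor_lift3 (fun x y z => F) t)
  (at level 41, x name, y name, z name, t at level 200, F at level 41,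
   format "\tsum_ ( x  \ox  y  \ox  z  <-  t )  F") : ring_scope.

Notation "\tsum_ ( a \ox b \ox c \ox d <- t ) F" :=
  (tensor_lift4 (fun a b c d => F) t)
  (at level 41, a name, b name, c name, d name, t at level 200, F at level 41,
   format "\tsum_ ( a  \ox  b  \ox  c  \ox  d  <-  t )  F") : ring_scope.

(** * Two-sided inverses in arbitrary rings *)

Section Inverse.
Variable R : nzRingType.
Implicit Types x y : R.

Definition is_inverse x y : Prop := y * x = 1 /\ x * y = 1.
Definition invertible x : Prop := exists y, is_inverse x y.

(* The inverse of x, with value 0 when x is not invertible. *)
Definition rinv x : R := xget 0 [set y | is_inverse x y]%classic.

Lemma rinvP x : invertible x -> is_inverse x (rinv x).
Proof.
by move=> [y xy]; exact: (@xgetPex _ 0 [set y | is_inverse x y]%classic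
                            (ex_intro _ y xy)).
Qed.

Lemma rinvE x y : is_inverse x y -> rinv x = y.
Proof.
move=> xy; have [zx _] := rinvP (ex_intro _ y xy).
by rewrite -[LHS]mulr1 -xy.2 mulrA zx mul1r.
Qed.

End Inverse.

(** * Ribbon quasi-Hopf algebras *)

(* The linear structure of the maps is bundled; multiplicativity and all other
   axioms are in the predicates below, so that data can be twisted by any F. *)
Record qtqHopf_data (K : fieldType) (A : algType K) := QtqHopfData {
  coprod : {linear A -> tensor2 A};
  counit : {scalar A};
  antipode : {linear A -> A};
  qalpha : A;
  qbeta : A;
  coassoc : tensor3 A;
  Rmx : tensor2 A
}.

Section QuasiHopf.
Variables (K : fieldType) (A : algType K) (H : qtqHopf_data A).

Local Notation Delta := (coprod H).
Local Notation eps := (counit H).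
Local Notation S := (antipode H).
Local Notation alpha := (qalpha H).
Local Notation beta := (qbeta H).
Local Notation Phi := (coassoc H).
Local Notation R := (Rmx H).

Record is_quasiHopf : Prop := IsQuasiHopf {
  counit_alg : monoid_morphism eps;
  coprod_alg : monoid_morphism Delta;
  antipode_antialg : S 1 = 1 /\ (forall a b, S (a * b) = S b * S a);
  coassoc_invertible : invertible Phi;
  quasi_coassociative : forall a : A,
    map_1D Delta (Delta a) = rinv Phi * map_D1 Delta (Delta a) * Phi;
  pentagon :
    map_D11 Delta Phi * map_11D Delta Phi
    = leg123 Phi * map_1D1 Delta Phi * leg234 Phi;
  counitl : forall a, map_e1 eps (Delta a) = a;
  counitr : forall a, map_1e eps (Delta a) = a;
  counit_coassoc : map_1e1 eps Phi = 1;
  antipode_alpha : forall a : A,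
    \tsum_(a1 \ox a2 <- Delta a) (S a1 * alpha * a2) = eps a *: alpha;
  antipode_beta : forall a : A,
    \tsum_(a1 \ox a2 <- Delta a) (a1 * beta * S a2) = eps a *: beta;
  antipode_coassocV :
    \tsum_(X \ox Y \ox Z <- rinv Phi) (X * beta * S Y * alpha * Z) = 1;
  antipode_coassoc :
    \tsum_(X \ox Y \ox Z <- Phi) (S X * alpha * Y * beta * S Z) = 1
}.

Record is_quasitriangular : Prop := IsQuasitriangular {
  Rmx_invertible : invertible R;
  Rmx_coprod : forall a : A, tensor_flip (Delta a) * R = R * Delta a;
  (* For t = X (x) Y (x) Z: t_231 = T23 (T12 t) = Y (x) Z (x) X and
     t_312 = T12 (T23 t) = Z (x) X (x) Y. *)
  hexagon_D1 :
    map_D1 Delta R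
    = T23 (T12 (rinv Phi)) * leg13 R * T23 Phi * leg23 R * rinv Phi;
  hexagon_1D :
    map_1D Delta R
    = T12 (T23 Phi) * leg13 R * T12 (rinv Phi) * leg12 R * Phi
}.

Definition drinfeld_u : A :=
  \tsum_(X \ox Y \ox Z <- Phi) \tsum_(a \ox b <- R)
    (S (Y * beta * S Z) * S b * alpha * a * X).

Definition twist_gamma : tensor2 A :=
  \tsum_(a \ox b \ox c \ox d <- leg123 (rinv Phi) * map_D11 Delta Phi)
    ((S b * alpha * c) \ox (S a * alpha * d)).

Definition drinfeld_twist : tensor2 A :=
  \tsum_(X \ox Y \ox Z <- Phi)
    (tensor_map S S (tensor_flip (Delta X)) * twist_gamma
       * Delta (Y * beta * S Z)).

Definition is_ribbon_element (v : A) : Prop :=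
  let u := drinfeld_u in
  let g := u * rinv v in
  [/\ forall a, v * a = a * v,
      v ^+ 2 = u * S u,
      S v = v,
      eps v = 1 &
      Delta g = rinv drinfeld_twist
                * tensor_map S S (tensor_flip drinfeld_twist) * (g \ox g)].

Definition is_ribbon : Prop :=
  [/\ is_quasiHopf, is_quasitriangular & exists v, is_ribbon_element v].

Definition is_twistor (F : tensor2 A) : Prop :=
  [/\ invertible F, map_e1 eps F = 1 & map_1e eps F = 1].

End QuasiHopf.

(** * Twisting *)

Section Twisting.
Variables (K : fieldType) (A : algType K) (H : qtqHopf_data A) (F : tensor2 A).

Local Notation Delta := (coprod H).
Local Notation S := (antipode H).

Definition twisted_coprod (a : A) : tensor2 A := F * Delta a * rinv F.

Fact twisted_coprod_linear : linear twisted_coprod.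
Proof.
move=> k a b; rewrite /twisted_coprod linearP mulrDr mulrDl.
by rewrite -scalerAr -scalerAl.
Qed.

HB.instance Definition _ :=
  GRing.isLinear.Build K A (tensor2 A) *:%R twisted_coprod twisted_coprod_linear.

Definition twist : qtqHopf_data A := {|
  coprod := twisted_coprod;
  counit := counit H;
  antipode := S;
  qalpha := \tsum_(f \ox g <- rinv F) (S f * qalpha H * g);
  qbeta := \tsum_(f \ox g <- F) (f * qbeta H * S g);
  coassoc := leg12 F * map_D1 Delta F * coassoc H
             * map_1D Delta (rinv F) * leg23 (rinv F);
  Rmx := tensor_flip F * Rmx H * rinv F
|}.

End Twisting.

(* Main.v *)
(** The algebra A is a right and a left A (x) A-module under
    a <| (x (x) y) = S(x) a y and (x (x) y) |> b = x b S(y); the axioms on alpha and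
    beta say that Delta(c) acts on them as eps(c), and twisting replaces them by
    alpha <| F^-1 and F |> beta.  In each element defined from Phi, Delta, alpha and
    beta, the outer factors F_12, F_23 of Phi_F therefore undo the twist of alpha and
    beta, while the factors (Delta (x) 1)F and (1 (x) Delta)F collapse to
    (eps (x) 1)F = 1 and (1 (x) eps)F = 1.  This gives u_F = u, and
    Twist_F = s(F^-1) Twist F^-1 for the Drinfeld twist, where s(x) = (S (x) S)x_21.
    The ribbon element v is thus unchanged: since S^2(a) g = g a for g = u v^-1, the
    factor (S^2 (x) S^2)(F^-1) can be moved through g (x) g to become the last factor
    of Delta_F(g) = F Delta(g) F^-1. *)
From HB Require Import structures.
Require Import Defs.
From mathcomp Require Import all_boot all_order all_algebra.
From mathcomp Require Import boolp classical_sets.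

Set Implicit Arguments.
Unset Strict Implicit.
Unset Printing Implicit Defensive.

Import GRing.Theory.
Local Open Scope ring_scope.

(** * Inverses and algebra morphisms *)

Section InverseTheory.
Variables (R : nzRingType) (x x' y y' : R).

Lemma is_inverseC : is_inverse x x' -> is_inverse x' x.
Proof. by case. Qed.

Lemma is_inverseM :
  is_inverse x x' -> is_inverse y y' -> is_inverse (x * y) (y' * x').
Proof.
move=> [x'x xx'] [y'y yy']; split.
  by rewrite -mulrA [x' * _]mulrA x'x mul1r.
by rewrite -mulrA [y * _]mulrA yy' mul1r.
Qed.

Lemma is_inverse_invertible : is_inverse x x' -> invertible x.
Proof. by exists x'. Qed.

Lemma is_inverseK : is_inverse x x' -> forall z, z * x * x' = z.
Proof. by move=> [_ xx'] z; rewrite -mulrA xx' mulr1. Qed.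

End InverseTheory.

Lemma rinv_invertibleN (R : nzRingType) (x : R) : ~ invertible x -> rinv x = 0.
Proof.
move=> Nx; rewrite /rinv; case: xgetP => // y _ xy.
by case: Nx; exists y.
Qed.

(* Also holds for a non-invertible [x], both sides then being [0]. *)
Lemma rinv_mul3 (R : nzRingType) (p p' x q q' : R) :
  is_inverse p p' -> is_inverse q q' -> rinv (p * x * q) = q' * rinv x * p'.
Proof.
move=> pp' qq'; have [[x' xx']|Nx] := pselect (invertible x).
  rewrite (rinvE xx'); apply: rinvE; rewrite -[q' * _ * _]mulrA.
  exact: is_inverseM (is_inverseM pp' xx') qq'.
rewrite (rinv_invertibleN Nx) mulr0 mul0r; apply: rinv_invertibleN => -[y xy].
apply: Nx; exists (q * y * p).
have := is_inverseM (is_inverseM (is_inverseC pp') xy) (is_inverseC qq').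
by rewrite !mulrA pp'.1 mul1r (is_inverseK qq').
Qed.

(** Lets [rinv v] pass every element when [v] is central. For invertible [x], [y] is moved across
    [x] between two copies of the inverse; otherwise [rinv x] has the default value 0. *)
Lemma rinv_comm (R : nzRingType) (x y : R) : x * y = y * x -> rinv x * y = y * rinv x.
Proof.
move=> xy; have [[x' [x'x xx']]|Nx] := pselect (invertible x); last first.
  by rewrite rinv_invertibleN // mul0r mulr0.
rewrite (rinvE (conj x'x xx')) -[LHS]mulr1 -xx' !mulrA -[x' * y * x]mulrA -xy.
by rewrite mulrA x'x mul1r.
Qed.

Section MonoidMorphism.
Variables R R' R'' : nzRingType.

Lemma monoid_morphism_comp (f : R -> R') (g : R' -> R'') :
  monoid_morphism f -> monoid_morphism g -> monoid_morphism (g \o f).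
Proof.
move=> [f1 fM] [g1 gM]; split; first by rewrite /= f1 g1.
by move=> x y; rewrite /= fM gM.
Qed.

Lemma is_inverse_morph (f : R -> R') (x y : R) :
  monoid_morphism f -> is_inverse x y -> is_inverse (f x) (f y).
Proof. by move=> [f1 fM] [yx xy]; rewrite /is_inverse -!fM yx xy f1. Qed.

End MonoidMorphism.

Section TensorMorphism.
Variables (K : fieldType) (A B C : algType K).

(** Both sides of multiplicativity are bilinear in [x] and [y] and pure tensors span, so pure
    tensors suffice. Flips, associators, tensor products of morphisms and the counit maps are
    reduced to this. *)
Lemma tensor_monoid_morphism (f : {linear tensor A B -> C}) :
    f 1 = 1 ->
    (forall a b c d, f ((a * c) \ox (b * d)) = f (a \ox b) * f (c \ox d)) ->
  monoid_morphism f.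
Proof.
move=> f1 fM; split=> // x y.
elim/tensor_ind: x => [|x x' IHx IHx'|a b]; first by rewrite !(mul0r, linear0).
  by rewrite mulrDl !linearD IHx IHx' mulrDl.
elim/tensor_ind: y => [|y y' IHy IHy'|c d]; first by rewrite !(mulr0, linear0).
  by rewrite mulrDr !linearD IHy IHy' mulrDr.
by rewrite oxM fM.
Qed.

End TensorMorphism.

Lemma tensor_map_morph (K : fieldType) (A B A' B' : algType K)
    (f : {linear A -> A'}) (g : {linear B -> B'}) :
  monoid_morphism f -> monoid_morphism g -> monoid_morphism (tensor_map f g).
Proof.
move=> [f1 fM] [g1 gM]; apply: tensor_monoid_morphism => /= [|a b c d].
  by have := tensor_mapE f g 1 1; rewrite f1 g1.
by rewrite !tensor_mapE fM gM oxM.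
Qed.

Lemma idfun_morph (R : nzRingType) : monoid_morphism (@idfun R).
Proof. by []. Qed.

Lemma tensor_flip_morph (K : fieldType) (A B : algType K) :
  monoid_morphism (@tensor_flip K A B).
Proof.
apply: tensor_monoid_morphism => /= [|a b c d]; first exact: tensor_flipE.
by rewrite !tensor_flipE oxM.
Qed.

Lemma tensor_flipK (K : fieldType) (U V : lmodType K) :
  cancel (@tensor_flip K U V) (@tensor_flip K V U).
Proof.
move=> x; elim/tensor_ind: x => [|x y IHx IHy|u v]; first by rewrite !linear0.
  by rewrite !linearD /= IHx IHy.
by rewrite !tensor_flipE.
Qed.

Lemma tensor_assocV_morph (K : fieldType) (A B C : algType K) :
  monoid_morphism (@tensor_assocV K A B C).
Proof.
apply: tensor_monoid_morphism => /= [|a x c y]; first exact: tensor_assocVE.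
elim/tensor_ind: x => [|x x' IHx IHx'|b b'].
- by rewrite mul0r !ox0r linear0 mul0r.
- by rewrite mulrDl !oxDr !linearD /= mulrDl IHx IHx'.
elim/tensor_ind: y => [|y y' IHy IHy'|d d'].
- by rewrite mulr0 !ox0r linear0 mulr0.
- by rewrite mulrDr !oxDr !linearD /= mulrDr IHy IHy'.
by rewrite oxM !tensor_assocVE !oxM.
Qed.

Lemma tensor_assoc_morph (K : fieldType) (A B C : algType K) :
  monoid_morphism (@tensor_assoc K A B C).
Proof.
apply: tensor_monoid_morphism => /= [|x a y c]; first exact: tensor_assocE.
elim/tensor_ind: x => [|x x' IHx IHx'|b b'].
- by rewrite mul0r !ox0l linear0 mul0r.
- by rewrite mulrDl !oxDl !linearD /= mulrDl IHx IHx'.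
elim/tensor_ind: y => [|y y' IHy IHy'|d d'].
- by rewrite mulr0 !ox0l linear0 mulr0.
- by rewrite mulrDr !oxDl !linearD /= mulrDr IHy IHy'.
by rewrite oxM !tensor_assocE !oxM.
Qed.

(** * Leg embeddings and permutations are algebra morphisms *)

Section LegTheory.
Variables (K : fieldType) (A : algType K).

Fact leg12_linear : linear (@leg12 K A).
Proof. by move=> k x y; rewrite /leg12 oxDl oxZl. Qed.
HB.instance Definition _ := GRing.isLinear.Build K (tensor2 A) (tensor3 A)
  *:%R (@leg12 K A) leg12_linear.

Fact leg23_linear : linear (@leg23 K A).
Proof. by move=> k x y; rewrite /leg23 oxDr oxZr linearP. Qed.
HB.instance Definition _ := GRing.isLinear.Build K (tensor2 A) (tensor3 A)
  *:%R (@leg23 K A) leg23_linear.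

HB.instance Definition _ := GRing.Linear.copy (@leg13 K A)
  (@T23 K A \o @leg12 K A).

Fact leg123_linear : linear (@leg123 K A).
Proof. by move=> k x y; rewrite /leg123 oxDl oxZl. Qed.
HB.instance Definition _ := GRing.isLinear.Build K (tensor3 A) (tensor4 A)
  *:%R (@leg123 K A) leg123_linear.

Fact leg234_linear : linear (@leg234 K A).
Proof. by move=> k x y; rewrite /leg234 oxDr oxZr !linearP. Qed.
HB.instance Definition _ := GRing.isLinear.Build K (tensor3 A) (tensor4 A)
  *:%R (@leg234 K A) leg234_linear.

Lemma oxl1_morph (B C : algType K) :
  monoid_morphism (fun x : B => x \ox (1 : C)).
Proof. by split=> // x y; rewrite oxM mulr1. Qed.

Lemma ox1r_morph (B C : algType K) :
  monoid_morphism (fun x : C => (1 : B) \ox x).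
Proof. by split=> // x y; rewrite oxM mulr1. Qed.

Lemma leg12_morph : monoid_morphism (@leg12 K A).
Proof. exact: oxl1_morph. Qed.

Lemma leg23_morph : monoid_morphism (@leg23 K A).
Proof.
exact: monoid_morphism_comp (ox1r_morph _ _) (@tensor_assocV_morph _ _ _ _).
Qed.

Lemma leg123_morph : monoid_morphism (@leg123 K A).
Proof. exact: oxl1_morph. Qed.

Lemma leg234_morph : monoid_morphism (@leg234 K A).
Proof.
apply: (@monoid_morphism_comp _ _ _
  (@tensor_assocV K A (tensor2 A) A \o tensor_pure 1)).
  exact: monoid_morphism_comp (ox1r_morph _ _) (@tensor_assocV_morph _ _ _ _).
apply: tensor_map_morph; last exact: idfun_morph.
exact: tensor_assocV_morph.
Qed.

Lemma T12_morph : monoid_morphism (@T12 K A).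
Proof. apply: tensor_map_morph; [exact: tensor_flip_morph|exact: idfun_morph]. Qed.

Lemma T23_morph : monoid_morphism (@T23 K A).
Proof.
apply: (@monoid_morphism_comp _ _ _ _ (@tensor_assocV K A A A)) => /=;
  last exact: tensor_assocV_morph.
apply: (@monoid_morphism_comp _ _ _ (@tensor_assoc K A A A)).
  exact: tensor_assoc_morph.
apply: tensor_map_morph; first exact: idfun_morph.
exact: tensor_flip_morph.
Qed.

Lemma leg13_morph : monoid_morphism (@leg13 K A).
Proof. exact: monoid_morphism_comp leg12_morph T23_morph. Qed.

End LegTheory.

(** * Leg maps induced by the coproduct and the counit *)

Section CoproductLegs.
Variables (K : fieldType) (A : algType K) (D : {linear A -> tensor2 A}).

HB.instance Definition _ := GRing.Linear.copy (map_D11 D)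
  (tensor_map (map_D1 D) idfun).
HB.instance Definition _ := GRing.Linear.copy (map_1D1 D)
  (tensor_map (map_1D D) idfun).
HB.instance Definition _ := GRing.Linear.copy (map_11D D)
  (@tensor_assocV K (tensor2 A) A A \o tensor_map idfun D).

Lemma map_D1E a b : map_D1 D (a \ox b) = D a \ox b.
Proof. exact: tensor_mapE. Qed.

Lemma map_1DE a b : map_1D D (a \ox b) = tensor_assocV (a \ox D b).
Proof. by rewrite /map_1D tensor_mapE. Qed.

Lemma map_D11E t a : map_D11 D (t \ox a) = map_D1 D t \ox a.
Proof. exact: tensor_mapE. Qed.

Lemma map_1D1E t a : map_1D1 D (t \ox a) = map_1D D t \ox a.
Proof. exact: tensor_mapE. Qed.

Lemma map_11DE t a : map_11D D (t \ox a) = tensor_assocV (t \ox D a).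
Proof. by rewrite /map_11D tensor_mapE. Qed.

Lemma map_D11_leg12 x : map_D11 D (leg12 x) = leg123 (map_D1 D x).
Proof. exact: map_D11E. Qed.

Lemma map_1D1_leg12 x : map_1D1 D (leg12 x) = leg123 (map_1D D x).
Proof. exact: map_1D1E. Qed.

Lemma map_11D_leg23 x : map_11D D (leg23 x) = leg234 (map_1D D x).
Proof.
elim/tensor_ind: x => [|x y IHx IHy|a b]; first by rewrite !linear0.
  by rewrite !linearD /= IHx IHy.
rewrite leg23E map_11DE map_1DE; elim/tensor_ind: (D b) => [|x y IHx IHy|c d].
- by rewrite !ox0r !linear0.
- by rewrite !oxDr !linearD /= IHx IHy.
by rewrite !tensor_assocVE leg234E.
Qed.

(** [D] hits each of the two factors once, on disjoint legs, so the order is immaterial;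
    [map_11D_map_D1] writes the common value as (D (x) D)x. *)
Lemma map_D11_map_1D x : map_D11 D (map_1D D x) = map_11D D (map_D1 D x).
Proof.
elim/tensor_ind: x => [|x y IHx IHy|a b]; first by rewrite !linear0.
  by rewrite !linearD /= IHx IHy.
rewrite map_1DE map_D1E map_11DE; elim/tensor_ind: (D b) => [|x y IHx IHy|c d].
- by rewrite !ox0r !linear0.
- by rewrite !oxDr !linearD /= IHx IHy.
by rewrite !tensor_assocVE map_D11E map_D1E.
Qed.

Lemma map_11D_map_D1 x :
  map_11D D (map_D1 D x) = tensor_assocV (tensor_map D D x).
Proof.
elim/tensor_ind: x => [|x y IHx IHy|a b]; first by rewrite !linear0.
  by rewrite !linearD /= IHx IHy.
by rewrite tensor_mapE map_D1E map_11DE.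
Qed.

Lemma map_1D1_leg23 x : map_1D1 D (leg23 x) = leg234 (map_D1 D x).
Proof.
elim/tensor_ind: x => [|x y IHx IHy|a b]; first by rewrite !linear0.
  by rewrite !linearD /= IHx IHy.
by rewrite leg23E map_1D1E map_1DE map_D1E /leg234 tensor_assocVE tensor_mapE.
Qed.

Hypothesis D_morph : monoid_morphism D.

Lemma map_D11_leg23 x : map_D11 D (leg23 x) = leg234 (leg23 x).
Proof.
elim/tensor_ind: x => [|x y IHx IHy|a b]; first by rewrite !linear0.
  by rewrite !linearD /= IHx IHy.
by rewrite leg23E map_D11E map_D1E leg234E D_morph.1.
Qed.

Lemma map_11D_leg12 x : map_11D D (leg12 x) = leg123 (leg12 x).
Proof. by rewrite map_11DE D_morph.1 tensor_assocVE. Qed.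

Lemma map_D1_morph : monoid_morphism (map_D1 D).
Proof. by apply: tensor_map_morph => //; exact: idfun_morph. Qed.

Lemma map_1D_morph : monoid_morphism (map_1D D).
Proof.
apply: (@monoid_morphism_comp _ _ _ (tensor_map idfun D)
  (@tensor_assocV K A A A)) => /=; last exact: tensor_assocV_morph.
by apply: tensor_map_morph => //; exact: idfun_morph.
Qed.

Lemma map_D11_morph : monoid_morphism (map_D11 D).
Proof. by apply: tensor_map_morph; [exact: map_D1_morph|exact: idfun_morph]. Qed.

Lemma map_1D1_morph : monoid_morphism (map_1D1 D).
Proof. by apply: tensor_map_morph; [exact: map_1D_morph|exact: idfun_morph]. Qed.

Lemma map_11D_morph : monoid_morphism (map_11D D).
Proof.
apply: (@monoid_morphism_comp _ _ _ (tensor_map idfun D)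
  (@tensor_assocV K (tensor2 A) A A)) => /=; last exact: tensor_assocV_morph.
by apply: tensor_map_morph => //; exact: idfun_morph.
Qed.

End CoproductLegs.

Section CounitLegs.
Variables (K : fieldType) (A : algType K) (eps : {scalar A}).

HB.instance Definition _ := GRing.Linear.copy (map_1e1 eps)
  (tensor_map (map_1e eps) idfun).

Lemma map_1e1E t a : map_1e1 eps (t \ox a) = map_1e eps t \ox a.
Proof. exact: tensor_mapE. Qed.

Hypothesis eps_morph : monoid_morphism eps.

Lemma map_e1_morph : monoid_morphism (map_e1 eps).
Proof.
apply: tensor_monoid_morphism => /= [|a b c d].
  by have := map_e1E eps 1 1; rewrite eps_morph.1 scale1r.
by rewrite !map_e1E eps_morph.2 -scalerAl -scalerAr scalerA.
Qed.

Lemma map_1e_morph : monoid_morphism (map_1e eps).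
Proof.
apply: tensor_monoid_morphism => /= [|a b c d].
  by have := map_1eE eps 1 1; rewrite eps_morph.1 scale1r.
by rewrite !map_1eE eps_morph.2 -scalerAl -scalerAr scalerA.
Qed.

Lemma map_1e1_morph : monoid_morphism (map_1e1 eps).
Proof. by apply: tensor_map_morph; [exact: map_1e_morph|exact: idfun_morph]. Qed.

Lemma map_1e1_leg23 x : map_1e1 eps (leg23 x) = 1 \ox map_e1 eps x.
Proof.
elim/tensor_ind: x => [|x y IHx IHy|a b]; first by rewrite !linear0 ox0r.
  by rewrite !linearD /= oxDr IHx IHy.
by rewrite leg23E map_1e1E map_1eE map_e1E oxZl oxZr.
Qed.

Variable D : {linear A -> tensor2 A}.

Lemma map_1e1_map_D1 x :
  (forall a, map_1e eps (D a) = a) -> map_1e1 eps (map_D1 D x) = x.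
Proof.
move=> De; elim/tensor_ind: x => [|x y IHx IHy|a b]; first by rewrite !linear0.
  by rewrite !linearD /= IHx IHy.
by rewrite map_D1E map_1e1E De.
Qed.

Lemma map_1e1_map_1D x :
  (forall a, map_e1 eps (D a) = a) -> map_1e1 eps (map_1D D x) = x.
Proof.
move=> De; elim/tensor_ind: x => [|x y IHx IHy|a b]; first by rewrite !linear0.
  by rewrite !linearD /= IHx IHy.
(* Writing the [b] on the right as (eps (x) 1)(D b) makes both sides linear in [D b], which may then
   be taken pure. *)
rewrite map_1DE -{2}[b]De; elim/tensor_ind: (D b) => [|x y IHx IHy|c d].
- by rewrite !linear0 !ox0r !linear0.
- by rewrite !linearD /= !oxDr !linearD /= IHx IHy.
by rewrite tensor_assocVE map_1e1E map_1eE map_e1E oxZl oxZr.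
Qed.

End CounitLegs.

(** * Quasi-coassociativity on fourfold tensors *)

Section QuasiCoassociativity.
Variables (K : fieldType) (A : algType K) (D : {linear A -> tensor2 A}).
Variables (Phi Phi' : tensor3 A).
Hypothesis PhiK : is_inverse Phi Phi'.
Hypothesis coassD : forall a,
  Phi * map_1D D (D a) = map_D1 D (D a) * Phi.

(** The second factor of [x] only rides along on leg 4, so on a pure tensor this is [coassD] for the
    first factor. *)
Lemma leg123_coass x :
  leg123 Phi * map_1D1 D (map_D1 D x) = map_D11 D (map_D1 D x) * leg123 Phi.
Proof.
elim/tensor_ind: x => [|x y IHx IHy|a b].
- by rewrite !linear0 mulr0 mul0r.
- by rewrite !linearD /= mulrDr mulrDl IHx IHy.
by rewrite map_D1E map_1D1E map_D11E /leg123 !oxM coassD mulr1 mul1r.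
Qed.

Lemma leg123_coassV x :
  leg123 Phi' * map_D11 D (map_D1 D x) = map_1D1 D (map_D1 D x) * leg123 Phi'.
Proof.
have [P'P PP'] := is_inverse_morph (@leg123_morph K A) PhiK.
rewrite -[LHS]mulr1 -PP' mulrA -[_ * _ * leg123 Phi]mulrA -leg123_coass.
by rewrite [leg123 Phi' * _]mulrA P'P mul1r.
Qed.

(* a (x) t as a fourfold tensor. *)
Let J (a : A) (t : tensor3 A) : tensor4 A :=
  tensor_map (@tensor_assocV K A A A) idfun (tensor_assocV (a \ox t)).

Let J_linear a : linear (J a).
Proof. by move=> k x y; rewrite /J oxDr oxZr !linearP. Qed.
HB.instance Definition _ a := GRing.isLinear.Build K (tensor3 A) (tensor4 A)
  *:%R (J a) (J_linear a).

Let JM a b s t : J a s * J b t = J (a * b) (s * t).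
Proof.
have assoc_morph : monoid_morphism (tensor_map (@tensor_assocV K A A A) (@idfun A)).
  by apply: tensor_map_morph; [exact: tensor_assocV_morph|exact: idfun_morph].
have := assoc_morph.2 (tensor_assocV (a \ox s)) (tensor_assocV (b \ox t)).
by rewrite -(tensor_assocV_morph A (tensor2 A) A).2 oxM => <-.
Qed.

Let JE a y c : J a (y \ox c) = tensor_assocV (a \ox y) \ox c.
Proof.
exact: etrans (congr1 (tensor_map (@tensor_assocV K A A A) idfun)
  (tensor_assocVE a y c)) (tensor_mapE _ _ _ _).
Qed.

Let J_map_D1 a x : map_1D1 D (tensor_assocV (a \ox x)) = J a (map_D1 D x).
Proof.
elim/tensor_ind: x => [|x y IHx IHy|b c].
- by rewrite ox0r !linear0.
- by rewrite oxDr !linearD /= IHx IHy.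
by rewrite tensor_assocVE map_1D1E map_1DE map_D1E; exact/esym/JE.
Qed.

Let J_map_1D a x : map_11D D (tensor_assocV (a \ox x)) = J a (map_1D D x).
Proof.
elim/tensor_ind: x => [|x y IHx IHy|b c].
- by rewrite ox0r !linear0.
- by rewrite oxDr !linearD /= IHx IHy.
rewrite tensor_assocVE map_11DE map_1DE.
elim/tensor_ind: (D c) => [|x y IHx IHy|d e].
- by rewrite !ox0r !linear0.
- by rewrite !oxDr !linearD /= IHx IHy.
rewrite !tensor_assocVE; apply: etrans (esym (JE _ _ _)).
by rewrite tensor_assocVE.
Qed.

(** Mirror image of [leg123_coass]: the first factor of [x] stays on leg 1, and with [leg234 Phi]
    read as [J 1 Phi] the identity becomes [coassD] inside [J]. *)
Lemma leg234_coass x :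
  leg234 Phi * map_11D D (map_1D D x) = map_1D1 D (map_1D D x) * leg234 Phi.
Proof.
elim/tensor_ind: x => [|x y IHx IHy|a b].
- by rewrite !linear0 mulr0 mul0r.
- by rewrite !linearD /= mulrDr mulrDl IHx IHy.
rewrite map_1DE J_map_D1 J_map_1D.
have -> : leg234 Phi = J 1 Phi by [].
by rewrite !JM coassD mulr1 mul1r.
Qed.

End QuasiCoassociativity.

(** * Actions of A (x) A on A *)

Section MultilinearLift.
Variables (K : fieldType) (A : algType K).

(** Separates the last argument of a multilinear map from the others; iterating this gives linearity
    of the threefold and fourfold lifts. *)
Lemma tensor_lift_bilinear (U V X W : lmodType K) (f : U -> V -> X -> W) :
    (forall z, bilinear_map (fun x y => f x y z)) ->
    (forall x y, linear (f x y)) ->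
  bilinear_map (fun (p : tensor U V) z => \tsum_(x \ox y <- p) f x y z).
Proof.
move=> f12 f3; split=> [z|p] k a b; first exact: tensor_lift_linear (f12 z) k a b.
rewrite /tensor_lift scaler_sumr -big_split /=.
by apply: eq_bigr => q _; exact: f3.
Qed.

Definition trilinear_map (W : lmodType K) (f : A -> A -> A -> W) : Prop :=
  (forall z, bilinear_map (fun x y => f x y z)) /\ (forall x y, linear (f x y)).

Lemma tensor_lift3_linear (W : lmodType K) (f : A -> A -> A -> W) :
  trilinear_map f -> linear (tensor_lift3 f).
Proof. by move=> [f12 f3]; exact/tensor_lift_linear/tensor_lift_bilinear. Qed.

Lemma tensor_lift3E (W : lmodType K) (f : A -> A -> A -> W) x y z :
  trilinear_map f -> tensor_lift3 f (x \ox y \ox z) = f x y z.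
Proof.
move=> [f12 f3]; have := tensor_liftE (tensor_lift_bilinear f12 f3) (x \ox y) z.
by rewrite (tensor_liftE (f12 z)).
Qed.

Definition quadrilinear_map (W : lmodType K) (f : A -> A -> A -> A -> W) : Prop :=
  (forall d, trilinear_map (fun a b c => f a b c d)) /\
  (forall a b c, linear (f a b c)).

Lemma tensor_lift3_bilinear (W : lmodType K) (f : A -> A -> A -> A -> W) :
  quadrilinear_map f ->
  bilinear_map (fun p d => tensor_lift3 (fun a b c => f a b c d) p).
Proof.
move=> [f3 f4].
apply: (tensor_lift_bilinear (f := fun (q : tensor2 A) c d =>
          \tsum_(a \ox b <- q) f a b c d)) => [d|q c].
  by apply: tensor_lift_bilinear; [exact: (f3 d).1|exact: (f3 d).2].
have f12 d : bilinear_map (fun a b => f a b c d) by exact: (f3 d).1.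
exact: (tensor_lift_bilinear f12 (fun a b => f4 a b c)).2.
Qed.

Lemma tensor_lift4_linear (W : lmodType K) (f : A -> A -> A -> A -> W) :
  quadrilinear_map f -> linear (tensor_lift4 f).
Proof. by move=> /tensor_lift3_bilinear; exact: tensor_lift_linear. Qed.

Lemma tensor_lift4E (W : lmodType K) (f : A -> A -> A -> A -> W) a b c d :
  quadrilinear_map f -> tensor_lift4 f (a \ox b \ox c \ox d) = f a b c d.
Proof.
move=> fP; have := tensor_liftE (tensor_lift3_bilinear fP) (a \ox b \ox c) d.
by rewrite (tensor_lift3E _ _ _ (fP.1 d)).
Qed.

Lemma tensor3_ind (P : tensor3 A -> Prop) :
  P 0 -> (forall x y, P x -> P y -> P (x + y)) ->
  (forall a b c, P (a \ox b \ox c)) -> forall x, P x.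
Proof.
move=> P0 PD Pp; apply: tensor_ind => // u c.
elim/tensor_ind: u => [|x y Px Py|//]; first by rewrite ox0l.
by rewrite oxDl; exact: PD.
Qed.

Lemma tensor4_ind (P : tensor4 A -> Prop) :
  P 0 -> (forall x y, P x -> P y -> P (x + y)) ->
  (forall a b c d, P (a \ox b \ox c \ox d)) -> forall x, P x.
Proof.
move=> P0 PD Pp; apply: tensor_ind => // u c.
elim/tensor3_ind: u => [|x y Px Py|//]; first by rewrite ox0l.
by rewrite oxDl; exact: PD.
Qed.

End MultilinearLift.

Section AntipodeActions.
Variables (K : fieldType) (A : algType K) (S : {linear A -> A}).

(** [A] and [S] are kept general because the action is used again with A (x) A in the role of [A]
    and [antipode21] in the role of [S]. *)
Definition actr (a : A) (x : tensor2 A) : A := \tsum_(p \ox q <- x) (S p * a * q).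

Fact actr_bilinear a : bilinear_map (fun p q : A => S p * a * q).
Proof.
split=> [q|p] k x y; first by rewrite linearP !mulrDl -!scalerAl.
by rewrite mulrDr -scalerAr.
Qed.
HB.instance Definition _ a := GRing.isLinear.Build K (tensor2 A) A *:%R (actr a)
  (tensor_lift_linear (actr_bilinear a)).

Lemma actrE a p q : actr a (p \ox q) = S p * a * q.
Proof. exact: tensor_liftE (actr_bilinear a) p q. Qed.

Definition actl (b : A) (x : tensor2 A) : A := \tsum_(p \ox q <- x) (p * b * S q).

Fact actl_bilinear b : bilinear_map (fun p q : A => p * b * S q).
Proof.
split=> [q|p] k x y; first by rewrite !mulrDl -!scalerAl.
by rewrite linearP mulrDr -scalerAr.
Qed.
HB.instance Definition _ b := GRing.isLinear.Build K (tensor2 A) A *:%R (actl b)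
  (tensor_lift_linear (actl_bilinear b)).

Lemma actlE b p q : actl b (p \ox q) = p * b * S q.
Proof. exact: tensor_liftE (actl_bilinear b) p q. Qed.

Hypothesis S1 : S 1 = 1.
Hypothesis SM : forall a b, S (a * b) = S b * S a.

Lemma actr1 a : actr a 1 = a.
Proof. by have := actrE a 1 1; rewrite S1 mul1r mulr1. Qed.

Lemma actl1 b : actl b 1 = b.
Proof. by have := actlE b 1 1; rewrite S1 mul1r mulr1. Qed.

(** [S] reverses products, so the factors of [y] end up outside those of [x]: this makes [actr] a
    right action. In [actlM] the same reversal gives a left action. *)
Lemma actrM a x y : actr a (x * y) = actr (actr a x) y.
Proof.
elim/tensor_ind: y => [|y y' IHy IHy'|p q]; first by rewrite mulr0 !linear0.
  by rewrite mulrDr !linearD /= IHy IHy'.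
rewrite [RHS]actrE; elim/tensor_ind: x => [|x x' IHx IHx'|r s].
- by rewrite mul0r !linear0 mulr0 mul0r.
- by rewrite mulrDl !linearD /= mulrDr mulrDl IHx IHx'.
by rewrite oxM !actrE SM !mulrA.
Qed.

Lemma actlM b x y : actl b (x * y) = actl (actl b y) x.
Proof.
elim/tensor_ind: x => [|x x' IHx IHx'|p q]; first by rewrite mul0r !linear0.
  by rewrite mulrDl !linearD /= IHx IHx'.
rewrite [RHS]actlE; elim/tensor_ind: y => [|y y' IHy IHy'|r s].
- by rewrite mulr0 !linear0 mulr0 mul0r.
- by rewrite mulrDr !linearD /= mulrDr mulrDl IHy IHy'.
by rewrite oxM !actlE SM !mulrA.
Qed.

Lemma actrZ k a x : actr (k *: a) x = k *: actr a x.
Proof.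
rewrite /actr /tensor_lift scaler_sumr; apply: eq_bigr => p _.
by rewrite -scalerAr -scalerAl.
Qed.

Lemma actlZ k b x : actl (k *: b) x = k *: actl b x.
Proof.
rewrite /actl /tensor_lift scaler_sumr; apply: eq_bigr => p _.
by rewrite -scalerAr -scalerAl.
Qed.

End AntipodeActions.

(** * Threefold and fourfold contractions *)

Section ThreefoldForms.
Variables (K : fieldType) (A : algType K) (S : {linear A -> A}).
Variables (D : {linear A -> tensor2 A}) (eps : {scalar A}).
Hypothesis SM : forall a b, S (a * b) = S b * S a.

Local Notation "a <| x" := (actr S a x) (at level 40, left associativity).
Local Notation "x |> b" := (actl S b x) (at level 40, left associativity).

(** The contraction of Phi^-1 from the antipode axioms, with [b], [a] free in place of beta, alpha,
    so that outer twist factors can be absorbed into them. *)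
Definition form_ba (b a : A) (t : tensor3 A) : A :=
  \tsum_(X \ox Y \ox Z <- t) (X * b * S Y * a * Z).

Fact form_ba_trilinear b a : trilinear_map (fun X Y Z : A => X * b * S Y * a * Z).
Proof.
split=> [Z|X Y]; last by move=> k x y; rewrite mulrDr -scalerAr.
split=> [Y|X] k x y; first by rewrite !mulrDl -!scalerAl.
by rewrite linearP mulrDr -scalerAr !mulrDl -!scalerAl.
Qed.
HB.instance Definition _ b a := GRing.isLinear.Build K (tensor3 A) A *:%R
  (form_ba b a) (tensor_lift3_linear (form_ba_trilinear b a)).

Lemma form_baE b a x y z : form_ba b a (x \ox y \ox z) = x * b * S y * a * z.
Proof. exact: tensor_lift3E (form_ba_trilinear b a). Qed.

Lemma form_ba12 b a (w : tensor2 A) z : form_ba b a (w \ox z) = (w |> b) * a * z.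
Proof.
elim/tensor_ind: w => [|x y IHx IHy|p q].
- by rewrite ox0l !linear0 !mul0r.
- by rewrite oxDl !linearD /= IHx IHy !mulrDl.
by rewrite form_baE actlE.
Qed.

Lemma form_ba23 b a x (w : tensor2 A) :
  form_ba b a (tensor_assocV (x \ox w)) = x * b * (a <| w).
Proof.
elim/tensor_ind: w => [|u v IHu IHv|p q].
- by rewrite ox0r !linear0 mulr0.
- by rewrite oxDr !linearD /= IHu IHv mulrDr.
by rewrite tensor_assocVE form_baE actrE !mulrA.
Qed.

Lemma form_ba_leg12 b a t x :
  form_ba b a (t * leg12 x) = form_ba (x |> b) a t.
Proof.
elim/tensor_ind: t => [|t t' IHt IHt'|w z]; first by rewrite mul0r !linear0.
  by rewrite mulrDl !linearD /= IHt IHt'.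
by rewrite oxM mulr1 !form_ba12 actlM.
Qed.

Lemma form_ba_leg23 b a t x :
  form_ba b a (leg23 x * t) = form_ba b (a <| x) t.
Proof.
elim/tensor3_ind: t => [|t t' IHt IHt'|p q r]; first by rewrite mulr0 !linear0.
  by rewrite mulrDr !linearD /= IHt IHt'.
rewrite -tensor_assocVE -(tensor_assocV_morph A A A).2 oxM mul1r.
by rewrite !form_ba23 actrM.
Qed.

(** The coproduct of the second factor of [x] lands on legs 2 and 3, where it acts on [a] through
    [eps]; only the first factor survives, on the far left. *)
Lemma form_ba_map_1D b a t x :
    (forall c, a <| D c = eps c *: a) ->
  form_ba b a (map_1D D x * t) = map_1e eps x * form_ba b a t.
Proof.
move=> aD; elim/tensor_ind: x => [|x x' IHx IHx'|c d].
- by rewrite !linear0 !mul0r linear0.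
- by rewrite !linearD /= !mulrDl linearD /= IHx IHx'.
elim/tensor3_ind: t => [|t t' IHt IHt'|p q r].
- by rewrite mulr0 !linear0 mulr0.
- by rewrite mulrDr !linearD /= IHt IHt' mulrDr.
rewrite map_1DE -tensor_assocVE -(tensor_assocV_morph A A A).2 oxM.
rewrite !form_ba23 actrM // aD actrZ map_1eE.
by rewrite -scalerAl -!scalerAr !mulrA.
Qed.

Lemma form_ba_map_D1 b a t x :
    (forall c, D c |> b = eps c *: b) ->
  form_ba b a (t * map_D1 D x) = form_ba b a t * map_e1 eps x.
Proof.
move=> bD; elim/tensor_ind: x => [|x x' IHx IHx'|c d].
- by rewrite !linear0 !mulr0 linear0.
- by rewrite !linearD /= !mulrDr linearD /= IHx IHx'.
elim/tensor_ind: t => [|t t' IHt IHt'|w z].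
- by rewrite mul0r !linear0 mul0r.
- by rewrite mulrDl !linearD /= IHt IHt' mulrDl.
rewrite map_D1E oxM !form_ba12 actlM // bD actlZ map_e1E.
by rewrite -!scalerAl -!scalerAr !mulrA.
Qed.

(** The companion contraction, from the antipode axiom on Phi itself. *)
Definition form_ab (a b : A) (t : tensor3 A) : A :=
  \tsum_(X \ox Y \ox Z <- t) (S X * a * Y * b * S Z).

Fact form_ab_trilinear a b : trilinear_map (fun X Y Z : A => S X * a * Y * b * S Z).
Proof.
split=> [Z|X Y]; last by move=> k x y; rewrite linearP mulrDr -scalerAr.
split=> [Y|X] k x y; first by rewrite linearP !mulrDl -!scalerAl.
by rewrite mulrDr -scalerAr !mulrDl -!scalerAl.
Qed.
HB.instance Definition _ a b := GRing.isLinear.Build K (tensor3 A) A *:%R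
  (form_ab a b) (tensor_lift3_linear (form_ab_trilinear a b)).

Lemma form_abE a b x y z : form_ab a b (x \ox y \ox z) = S x * a * y * b * S z.
Proof. exact: tensor_lift3E (form_ab_trilinear a b). Qed.

Lemma form_ab12 a b (w : tensor2 A) z : form_ab a b (w \ox z) = (a <| w) * b * S z.
Proof.
elim/tensor_ind: w => [|x y IHx IHy|p q].
- by rewrite ox0l !linear0 !mul0r.
- by rewrite oxDl !linearD /= IHx IHy !mulrDl.
by rewrite form_abE actrE.
Qed.

Lemma form_ab23 a b x (w : tensor2 A) :
  form_ab a b (tensor_assocV (x \ox w)) = S x * a * (w |> b).
Proof.
elim/tensor_ind: w => [|u v IHu IHv|p q].
- by rewrite ox0r !linear0 mulr0.
- by rewrite oxDr !linearD /= IHu IHv mulrDr.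
by rewrite tensor_assocVE form_abE actlE !mulrA.
Qed.

Lemma form_ab_leg12 a b t x :
  form_ab a b (leg12 x * t) = form_ab (a <| x) b t.
Proof.
elim/tensor_ind: t => [|t t' IHt IHt'|w z]; first by rewrite mulr0 !linear0.
  by rewrite mulrDr !linearD /= IHt IHt'.
by rewrite oxM mul1r !form_ab12 actrM.
Qed.

Lemma form_ab_leg23 a b t x :
  form_ab a b (t * leg23 x) = form_ab a (x |> b) t.
Proof.
elim/tensor3_ind: t => [|t t' IHt IHt'|p q r]; first by rewrite mul0r !linear0.
  by rewrite mulrDl !linearD /= IHt IHt'.
rewrite -tensor_assocVE -(tensor_assocV_morph A A A).2 oxM mulr1.
by rewrite !form_ab23 actlM.
Qed.

(** Legs 1 and 2 contract with [a] and leave only [eps]. The second factor of [x] multiplies leg 3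
    from the left, under [S], hence comes out on the far right. *)
Lemma form_ab_map_D1 a b t x :
    (forall c, a <| D c = eps c *: a) ->
  form_ab a b (map_D1 D x * t) = form_ab a b t * S (map_e1 eps x).
Proof.
move=> aD; elim/tensor_ind: x => [|x x' IHx IHx'|c d].
- by rewrite !linear0 !(mul0r, mulr0) linear0.
- by rewrite !linearD /= mulrDl mulrDr linearD /= IHx IHx'.
elim/tensor_ind: t => [|t t' IHt IHt'|w z].
- by rewrite mulr0 !linear0 mul0r.
- by rewrite mulrDr !linearD /= IHt IHt' mulrDl.
rewrite map_D1E oxM !form_ab12 actrM // aD actrZ map_e1E linearZ /= SM.
by rewrite -!scalerAl -!scalerAr !mulrA.
Qed.

Lemma form_ab_map_1D a b t x :
    (forall c, D c |> b = eps c *: b) ->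
  form_ab a b (t * map_1D D x) = S (map_1e eps x) * form_ab a b t.
Proof.
move=> bD; elim/tensor_ind: x => [|x x' IHx IHx'|c d].
- by rewrite !linear0 !(mul0r, mulr0) linear0.
- by rewrite !linearD /= mulrDl mulrDr linearD /= IHx IHx'.
elim/tensor3_ind: t => [|t t' IHt IHt'|p q r].
- by rewrite mul0r !linear0 mulr0.
- by rewrite mulrDl !linearD /= IHt IHt' mulrDr.
rewrite map_1DE -tensor_assocVE -(tensor_assocV_morph A A A).2 oxM.
rewrite !form_ab23 actlM // bD actlZ map_1eE linearZ /= SM.
by rewrite -!scalerAl -!scalerAr !mulrA.
Qed.

(** The sum defining u, where [c] stands for the part contracted with R, namely S(b_nu) alpha
    a_nu. *)
Definition form_u (b c : A) (t : tensor3 A) : A :=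
  \tsum_(X \ox Y \ox Z <- t) (S (Y * b * S Z) * c * X).

Fact form_u_trilinear b c : trilinear_map (fun X Y Z : A => S (Y * b * S Z) * c * X).
Proof.
split=> [Z|X Y]; last first.
  by move=> k x y; rewrite linearP mulrDr -scalerAr linearP !mulrDl -!scalerAl.
split=> [Y|X] k x y; first by rewrite mulrDr -scalerAr.
by rewrite !mulrDl -!scalerAl linearP !mulrDl -!scalerAl.
Qed.
HB.instance Definition _ b c := GRing.isLinear.Build K (tensor3 A) A *:%R
  (form_u b c) (tensor_lift3_linear (form_u_trilinear b c)).

Lemma form_uE b c x y z : form_u b c (x \ox y \ox z) = S (y * b * S z) * c * x.
Proof. exact: tensor_lift3E (form_u_trilinear b c). Qed.

(** Leg 2 lies under [S] and leg 1 does not, so this pair acts on [c] in flipped order. *)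
Lemma form_u12 b c (w : tensor2 A) z :
  form_u b c (w \ox z) = S (b * S z) * (c <| tensor_flip w).
Proof.
elim/tensor_ind: w => [|x y IHx IHy|p q].
- by rewrite ox0l !linear0 !mulr0.
- by rewrite oxDl !linearD /= IHx IHy !mulrDr.
by rewrite form_uE tensor_flipE actrE -[_ * b * _]mulrA SM !mulrA.
Qed.

Lemma form_u23 b c x (w : tensor2 A) :
  form_u b c (tensor_assocV (x \ox w)) = S (w |> b) * c * x.
Proof.
elim/tensor_ind: w => [|u v IHu IHv|p q].
- by rewrite ox0r !linear0 !mul0r.
- by rewrite oxDr !linearD /= IHu IHv !mulrDl.
by rewrite tensor_assocVE form_uE actlE.
Qed.

Lemma form_u_leg23 b c t x :
  form_u b c (t * leg23 x) = form_u (x |> b) c t.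
Proof.
elim/tensor3_ind: t => [|t t' IHt IHt'|p q r]; first by rewrite mul0r !linear0.
  by rewrite mulrDl !linearD /= IHt IHt'.
rewrite -tensor_assocVE -(tensor_assocV_morph A A A).2 oxM mulr1.
by rewrite !form_u23 actlM.
Qed.

Lemma form_u_map_1D b c t x :
    (forall d, D d |> b = eps d *: b) ->
  form_u b c (t * map_1D D x) = form_u b c t * map_1e eps x.
Proof.
move=> bD; elim/tensor_ind: x => [|x x' IHx IHx'|d e].
- by rewrite !linear0 !mulr0 linear0.
- by rewrite !linearD /= !mulrDr linearD /= IHx IHx'.
elim/tensor3_ind: t => [|t t' IHt IHt'|p q r].
- by rewrite mul0r !linear0 mul0r.
- by rewrite mulrDl !linearD /= IHt IHt' mulrDl.
rewrite map_1DE -tensor_assocVE -(tensor_assocV_morph A A A).2 oxM.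
rewrite !form_u23 actlM // bD actlZ map_1eE linearZ /=.
by rewrite -!scalerAl -!scalerAr !mulrA.
Qed.

Lemma form_u_leg12 b c t x :
  form_u b c (leg12 x * t) = form_u b (c <| tensor_flip x) t.
Proof.
elim/tensor_ind: t => [|t t' IHt IHt'|w z]; first by rewrite mulr0 !linear0.
  by rewrite mulrDr !linearD /= IHt IHt'.
by rewrite oxM mul1r !form_u12 (tensor_flip_morph A A).2 actrM.
Qed.

(** The source of S^2: legs 1 and 2 contract with [c], and leg 3 lies under two antipodes, which
    together preserve the order of products. *)
Lemma form_u_map_D1 b c t x :
    (forall d, c <| tensor_flip (D d) = eps d *: c) ->
  form_u b c (map_D1 D x * t) = S (S (map_e1 eps x)) * form_u b c t.
Proof.
move=> cD; elim/tensor_ind: x => [|x x' IHx IHx'|d e].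
- by rewrite !linear0 !mul0r linear0.
- by rewrite !linearD /= !mulrDl linearD /= IHx IHx'.
elim/tensor_ind: t => [|t t' IHt IHt'|w z].
- by rewrite mulr0 !linear0 mulr0.
- by rewrite mulrDr !linearD /= IHt IHt' mulrDr.
rewrite map_D1E oxM !form_u12 (tensor_flip_morph A A).2 actrM // cD actrZ.
rewrite map_e1E !linearZ /= -!scalerAr -!scalerAl; congr (_ *: _).
by rewrite !SM !mulrA.
Qed.

End ThreefoldForms.

(** * The Drinfeld twist and gamma as contractions *)

Section DrinfeldForms.
Variables (K : fieldType) (A : algType K) (S : {linear A -> A}).
Variables (D : {linear A -> tensor2 A}) (eps : {scalar A}).
Hypothesis S1 : S 1 = 1.
Hypothesis SM : forall a b, S (a * b) = S b * S a.
Hypothesis D_morph : monoid_morphism D.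

(** Serves as an antipode on A (x) A: it reverses products like [S], so the theory of [actr] applies
    to it. *)
Definition antipode21 (x : tensor2 A) : tensor2 A := tensor_map S S (tensor_flip x).
HB.instance Definition _ := GRing.Linear.copy antipode21
  (tensor_map S S \o @tensor_flip K A A).

Lemma antipode21E a b : antipode21 (a \ox b) = S b \ox S a.
Proof. by rewrite /antipode21 tensor_flipE tensor_mapE. Qed.

Lemma antipode21_1 : antipode21 1 = 1.
Proof. by have := antipode21E 1 1; rewrite S1. Qed.

Lemma antipode21M x y : antipode21 (x * y) = antipode21 y * antipode21 x.
Proof.
elim/tensor_ind: x => [|x x' IHx IHx'|a b].
- by rewrite mul0r linear0 mulr0.
- by rewrite mulrDl !linearD /= IHx IHx' mulrDr.
elim/tensor_ind: y => [|y y' IHy IHy'|c d].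
- by rewrite mulr0 linear0 mul0r.
- by rewrite mulrDr !linearD /= IHy IHy' mulrDl.
by rewrite oxM !antipode21E !SM oxM.
Qed.

Lemma antipode21_inverse x y :
  is_inverse x y -> is_inverse (antipode21 x) (antipode21 y).
Proof.
by move=> [yx xy]; split; rewrite -antipode21M ?xy ?yx antipode21_1.
Qed.

(** The Drinfeld twist with free parameters: [g] replaces gamma and takes the place that alpha has
    in [form_ab]. *)
Definition form_twist (g : tensor2 A) (b : A) (t : tensor3 A) : tensor2 A :=
  \tsum_(X \ox Y \ox Z <- t) (antipode21 (D X) * g * D (Y * b * S Z)).

Fact form_twist_trilinear g b :
  trilinear_map (fun X Y Z : A => antipode21 (D X) * g * D (Y * b * S Z)).
Proof.
split=> [Z|X Y]; last first.
  by move=> k x y; rewrite linearP mulrDr -scalerAr linearP mulrDr -scalerAr.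
split=> [Y|X] k x y; first by rewrite !linearP !mulrDl -!scalerAl.
by rewrite !mulrDl -!scalerAl linearP mulrDr -scalerAr.
Qed.
HB.instance Definition _ g b := GRing.isLinear.Build K (tensor3 A) (tensor2 A) *:%R
  (form_twist g b) (tensor_lift3_linear (form_twist_trilinear g b)).

Lemma form_twistE g b x y z :
  form_twist g b (x \ox y \ox z) = antipode21 (D x) * g * D (y * b * S z).
Proof. exact: tensor_lift3E (form_twist_trilinear g b). Qed.

Lemma form_twist12 g b (w : tensor2 A) z :
  form_twist g b (w \ox z) = actr antipode21 g (tensor_map D D w) * D (b * S z).
Proof.
elim/tensor_ind: w => [|x y IHx IHy|p q].
- by rewrite ox0l !linear0 !mul0r.
- by rewrite oxDl !linearD /= IHx IHy !mulrDl.
by rewrite form_twistE tensor_mapE actrE -[q * b * _]mulrA D_morph.2 !mulrA.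
Qed.

Lemma form_twist23 g b x (w : tensor2 A) :
  form_twist g b (tensor_assocV (x \ox w)) = antipode21 (D x) * g * D (actl S b w).
Proof.
elim/tensor_ind: w => [|u v IHu IHv|p q].
- by rewrite ox0r !linear0 mulr0.
- by rewrite oxDr !linearD /= IHu IHv mulrDr.
by rewrite tensor_assocVE form_twistE actlE.
Qed.

Lemma form_twist_leg12 g b t x :
  form_twist g b (leg12 x * t)
  = form_twist (actr antipode21 g (tensor_map D D x)) b t.
Proof.
elim/tensor_ind: t => [|t t' IHt IHt'|w z]; first by rewrite mulr0 !linear0.
  by rewrite mulrDr !linearD /= IHt IHt'.
rewrite oxM mul1r !form_twist12 (tensor_map_morph D_morph D_morph).2.
by rewrite (actrM antipode21M).
Qed.

Lemma form_twist_leg23 g b t x :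
  form_twist g b (t * leg23 x) = form_twist g (actl S b x) t.
Proof.
elim/tensor3_ind: t => [|t t' IHt IHt'|p q r]; first by rewrite mul0r !linear0.
  by rewrite mulrDl !linearD /= IHt IHt'.
rewrite -tensor_assocVE -(tensor_assocV_morph A A A).2 oxM mulr1.
by rewrite !form_twist23 actlM.
Qed.

Lemma form_twist_map_1D g b t x :
    (forall d, actl S b (D d) = eps d *: b) ->
  form_twist g b (t * map_1D D x)
  = antipode21 (D (map_1e eps x)) * form_twist g b t.
Proof.
move=> bD; elim/tensor_ind: x => [|x x' IHx IHx'|d e].
- by rewrite !linear0 mulr0 !linear0 mul0r.
- by rewrite !linearD /= mulrDr mulrDl linearD /= IHx IHx'.
elim/tensor3_ind: t => [|t t' IHt IHt'|p q r].
- by rewrite mul0r !linear0 mulr0.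
- by rewrite mulrDl !linearD /= IHt IHt' mulrDr.
rewrite map_1DE -tensor_assocVE -(tensor_assocV_morph A A A).2 oxM.
rewrite !form_twist23 actlM // bD actlZ map_1eE !linearZ /= D_morph.2 antipode21M.
by rewrite -!scalerAr -!scalerAl !mulrA.
Qed.

(** The mechanism of [form_ab_map_D1] one level up: [g] absorbs (D (x) D)(D d) as [eps d], and the
    factor left on leg 3 passes through [S] and then [D]. *)
Lemma form_twist_map_D1 g b t x :
    (forall d, actr antipode21 g (tensor_map D D (D d)) = eps d *: g) ->
  form_twist g b (map_D1 D x * t) = form_twist g b t * D (S (map_e1 eps x)).
Proof.
move=> gD; elim/tensor_ind: x => [|x x' IHx IHx'|d e].
- by rewrite !linear0 mul0r !linear0 mulr0.
- by rewrite !linearD /= mulrDl mulrDr linearD /= IHx IHx'.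
elim/tensor_ind: t => [|t t' IHt IHt'|w z].
- by rewrite mulr0 !linear0 mul0r.
- by rewrite mulrDr !linearD /= IHt IHt' mulrDl.
rewrite map_D1E oxM !form_twist12 (tensor_map_morph D_morph D_morph).2.
rewrite (actrM antipode21M) gD actrZ map_e1E !linearZ /= -!scalerAr -!scalerAl.
by rewrite SM -[in RHS]mulrA -D_morph.2 mulrA.
Qed.

(** Two nested pairings: [a] is contracted with the inner legs 2 and 3, [b] with the outer legs 1
    and 4. *)
Definition form_gamma (a b : A) (t : tensor4 A) : tensor2 A :=
  \tsum_(p \ox q \ox r \ox s <- t) ((S q * a * r) \ox (S p * b * s)).

Fact form_gamma_quadrilinear a b :
  quadrilinear_map (fun p q r s : A => (S q * a * r) \ox (S p * b * s)).
Proof.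
split=> [s|p q r]; last by move=> k x y; rewrite mulrDr -scalerAr oxDr oxZr.
split=> [r|p q]; last by move=> k x y; rewrite mulrDr -scalerAr oxDl oxZl.
split=> [q|p] k x y; first by rewrite linearP !mulrDl -!scalerAl oxDr oxZr.
by rewrite linearP !mulrDl -!scalerAl oxDl oxZl.
Qed.
HB.instance Definition _ a b := GRing.isLinear.Build K (tensor4 A) (tensor2 A) *:%R
  (form_gamma a b) (tensor_lift4_linear (form_gamma_quadrilinear a b)).

Lemma form_gammaE a b p q r s :
  form_gamma a b (p \ox q \ox r \ox s) = (S q * a * r) \ox (S p * b * s).
Proof. exact: tensor_lift4E (form_gamma_quadrilinear a b). Qed.

Lemma form_gamma_inner a b p (w : tensor2 A) s :
  form_gamma a b (tensor_assocV (p \ox w) \ox s) = actr S a w \ox (S p * b * s).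
Proof.
elim/tensor_ind: w => [|u v IHu IHv|q r].
- by rewrite ox0r linear0 !ox0l !linear0 ox0l.
- by rewrite oxDr linearD oxDl !linearD /= IHu IHv oxDl.
by rewrite tensor_assocVE form_gammaE actrE.
Qed.

Lemma form_gamma_leg23 a b x t :
  form_gamma a b (leg123 (leg23 x) * t) = form_gamma (actr S a x) b t.
Proof.
elim/tensor4_ind: t => [|t t' IHt IHt'|p q r s]; first by rewrite mulr0 !linear0.
  by rewrite mulrDr !linearD /= IHt IHt'.
rewrite -(tensor_assocVE p q r) /leg123 oxM -(tensor_assocV_morph A A A).2 oxM !mul1r.
by rewrite !form_gamma_inner actrM.
Qed.

(** The coproduct sits on the inner legs and contracts with [a]; the outer legs of [y] then act on
    [b], weighted by [eps] of its middle leg. *)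
Lemma form_gamma_map_1D1 a b y t :
    (forall c, actr S a (D c) = eps c *: a) ->
  form_gamma a b (map_1D1 D y * t) = form_gamma a (actr S b (map_1e1 eps y)) t.
Proof.
move=> aD.
elim/tensor4_ind: t => [|t t' IHt IHt'|p q r s]; first by rewrite mulr0 !linear0.
  by rewrite mulrDr !linearD /= IHt IHt'.
rewrite form_gammaE; elim/tensor3_ind: y => [|y y' IHy IHy'|c d e].
- by rewrite !linear0 mul0r linear0 mulr0 mul0r ox0r.
- by rewrite !linearD /= mulrDl linearD /= IHy IHy' mulrDr mulrDl oxDr.
rewrite map_1D1E map_1DE -(tensor_assocVE p q r) oxM -(tensor_assocV_morph A A A).2 oxM.
rewrite form_gamma_inner actrM // aD actrZ map_1e1E map_1eE actrE !actrE.
rewrite linearZ /= -!scalerAl -!scalerAr -scalerAl oxZl oxZr; congr (_ *: _).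
by rewrite SM !mulrA.
Qed.

Lemma form_gammaZr a k b t : form_gamma a (k *: b) t = k *: form_gamma a b t.
Proof.
elim/tensor4_ind: t => [|t t' IHt IHt'|p q r s]; first by rewrite !linear0.
  by rewrite !linearD /= IHt IHt'.
by rewrite !form_gammaE -scalerAr -scalerAl oxZr.
Qed.

(** Legs 1 and 2 carry antipodes and appear in swapped order, legs 3 and 4 appear plainly on the
    right; a right factor therefore acts on the result through [antipode21]. *)
Lemma form_gamma_assocV a b t x :
  form_gamma a b (t * tensor_assocV x) = actr antipode21 (form_gamma a b t) x.
Proof.
elim/tensor_ind: x => [|x x' IHx IHx'|x y]; first by rewrite !linear0 mulr0 linear0.
  by rewrite !linearD mulrDr linearD /= IHx IHx'.
elim/tensor4_ind: t => [|t t' IHt IHt'|p q r s].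
- by rewrite mul0r !linear0 actrE mulr0 mul0r.
- by rewrite mulrDl !linearD /= IHt IHt' !actrE mulrDr mulrDl.
rewrite form_gammaE actrE /=; elim/tensor_ind: x => [|x x' IHx IHx'|c d].
- by rewrite ox0l !linear0 mulr0 linear0 !mul0r.
- by rewrite oxDl !linearD /= mulrDr !mulrDl linearD /= IHx IHx'.
elim/tensor_ind: y => [|y y' IHy IHy'|e f].
- by rewrite ox0r linear0 !mulr0 linear0.
- by rewrite oxDr linearD /= !mulrDr linearD /= IHy IHy'.
by rewrite tensor_assocVE antipode21E !oxM form_gammaE !SM !mulrA.
Qed.

End DrinfeldForms.

(** * Pentagon and hexagons *)

(** The [f]s are [F] on neighbouring legs, [P1], [P2], [P3], [Pl], [Pr] the five images of Phi, the
    other letters images of [F] and its inverse under coproducts. Moving [f12'] past [f34], [m] past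
    [Pl] and [m'] past [Pr] makes inverse pairs cancel around the untwisted pentagon. *)
Lemma pentagon_word (R : nzRingType)
    (f12 f12' f23 f23' f34 f34' d1 d2 d2' c1 c1' c2' dd dd' l m m' r'
     P1 P2 P3 Pl Pr : R) :
    is_inverse f12 f12' -> is_inverse f23 f23' -> is_inverse f34 f34' ->
    is_inverse d2 d2' -> is_inverse c1 c1' -> is_inverse dd dd' ->
    f12' * f34 = f34 * f12' -> Pl * m = l * Pl -> Pr * r' = m' * Pr ->
    P1 * P3 = Pl * P2 * Pr ->
  (f12 * (d1 * l * P1 * dd' * f34') * f12')
    * (f34 * (f12 * dd * P3 * r' * c2') * f34')
  = (f12 * d1 * Pl * d2' * f23') * (f23 * (d2 * m * P2 * m' * c1') * f23')
    * (f23 * c1 * Pr * c2' * f34').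
Proof.
move=> /is_inverseC f12K /is_inverseC f23K /is_inverseC f34K /is_inverseC d2K.
move=> /is_inverseC c1K /is_inverseC ddK fC Plm Prr pent.
rewrite !mulrA -[_ * f12' * f34]mulrA fC !mulrA (is_inverseK f34K).
rewrite (is_inverseK f12K) (is_inverseK ddK) !(is_inverseK f23K).
rewrite (is_inverseK d2K) (is_inverseK c1K) -[_ * Pl * m]mulrA Plm !mulrA.
by rewrite -[_ * m' * Pr]mulrA -Prr -[_ * P1 * P3]mulrA pent !mulrA.
Qed.

(** Common to both hexagons: [r1], [r2] are the two copies of R and [p1], [p2], [p] those of Phi or
    its inverse. The last two hypotheses carry coproduct images of the twistor through R, where they
    meet their inverses. *)
Lemma hexagon_word (R : nzRingType)
    (f f' a p1 e e' g g' r1 h h' k p2 j j' i i' r2 w w' q p b' : R) :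
    is_inverse e e' -> is_inverse g g' -> is_inverse h h' -> is_inverse j j' ->
    is_inverse i i' -> is_inverse w w' ->
    r1 * k = e * r1 -> r2 * q = j * r2 ->
  f * (a * (p1 * r1 * p2 * r2 * p) * b') * f'
  = (f * a * p1 * e' * g') * (g * r1 * h') * (h * k * p2 * j' * i')
    * (i * r2 * w') * (w * q * p * b' * f').
Proof.
move=> /is_inverseC eK /is_inverseC gK /is_inverseC hK /is_inverseC jK.
move=> /is_inverseC iK /is_inverseC wK rk rq.
rewrite !mulrA (is_inverseK gK) (is_inverseK hK) (is_inverseK iK) (is_inverseK wK).
rewrite -[_ * r1 * k]mulrA rk !mulrA (is_inverseK eK).
by rewrite -[_ * r2 * q]mulrA rq !mulrA (is_inverseK jK).
Qed.

(** * Permuting legs, and passing coproducts through R *)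

Section LegPermutations.
Variables (K : fieldType) (A : algType K).
Implicit Types (x : tensor2 A) (t : tensor3 A).

Lemma leg234_leg12 x : leg234 (leg12 x) = leg123 (leg23 x).
Proof.
elim/tensor_ind: x => [|x y IHx IHy|a b]; first by rewrite !linear0.
  by rewrite !linearD /= IHx IHy.
by rewrite leg234E leg23E.
Qed.

Lemma leg234_leg23 x : leg234 (leg23 x) = tensor_assocV (1 \ox x).
Proof.
elim/tensor_ind: x => [|x y IHx IHy|a b]; first by rewrite ox0r !linear0.
  by rewrite oxDr !linearD /= IHx IHy.
by rewrite leg23E leg234E tensor_assocVE.
Qed.

Lemma leg123_leg12 x : leg123 (leg12 x) = tensor_assocV (x \ox 1).
Proof. by rewrite -[in RHS]ox11 tensor_assocVE. Qed.

Lemma T12_ox x a : T12 (x \ox a) = tensor_flip x \ox a.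
Proof. exact: tensor_mapE. Qed.

Lemma T23_assocV a x :
  T23 (tensor_assocV (a \ox x)) = tensor_assocV (a \ox tensor_flip x).
Proof.
elim/tensor_ind: x => [|x y IHx IHy|b c]; first by rewrite linear0 ox0r !linear0.
  by rewrite linearD !oxDr !linearD /= IHx IHy.
by rewrite tensor_flipE !tensor_assocVE T23E.
Qed.

Lemma T12_leg12 x : T12 (leg12 x) = leg12 (tensor_flip x).
Proof. exact: T12_ox. Qed.

Lemma T23_leg23 x : T23 (leg23 x) = leg23 (tensor_flip x).
Proof. exact: T23_assocV. Qed.

Lemma T12_leg23 x : T12 (leg23 x) = leg13 x.
Proof.
elim/tensor_ind: x => [|x y IHx IHy|a b]; first by rewrite !linear0.
  by rewrite !linearD /= IHx IHy.
by rewrite leg23E T12E leg13E.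
Qed.

Lemma T12_leg13 x : T12 (leg13 x) = leg23 x.
Proof.
elim/tensor_ind: x => [|x y IHx IHy|a b]; first by rewrite !linear0.
  by rewrite !linearD /= IHx IHy.
by rewrite leg23E leg13E T12E.
Qed.

Lemma T23_leg13 x : T23 (leg13 x) = leg12 x.
Proof.
elim/tensor_ind: x => [|x y IHx IHy|a b]; first by rewrite !linear0.
  by rewrite !linearD /= IHx IHy.
by rewrite leg13E T23E.
Qed.

Variable D : {linear A -> tensor2 A}.

Lemma T231_map_1D x : T23 (T12 (map_1D D x)) = map_D1 D (tensor_flip x).
Proof.
elim/tensor_ind: x => [|x y IHx IHy|a b]; first by rewrite !linear0.
  by rewrite !linearD /= IHx IHy.
rewrite map_1DE tensor_flipE map_D1E.
elim/tensor_ind: (D b) => [|x y IHx IHy|c d]; first by rewrite ox0r ox0l !linear0.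
  by rewrite oxDr oxDl !linearD /= IHx IHy.
by rewrite tensor_assocVE T12E T23E.
Qed.

Lemma T312_map_D1 x : T12 (T23 (map_D1 D x)) = map_1D D (tensor_flip x).
Proof.
elim/tensor_ind: x => [|x y IHx IHy|a b]; first by rewrite !linear0.
  by rewrite !linearD /= IHx IHy.
rewrite map_D1E tensor_flipE map_1DE.
elim/tensor_ind: (D a) => [|x y IHx IHy|c d]; first by rewrite ox0r ox0l !linear0.
  by rewrite oxDr oxDl !linearD /= IHx IHy.
by rewrite tensor_assocVE T23E T12E.
Qed.

Variable r : tensor2 A.
Hypothesis rD : forall a, tensor_flip (D a) * r = r * D a.

Lemma leg12_map_D1C x :
  leg12 r * map_D1 D x = T12 (map_D1 D x) * leg12 r.
Proof.
elim/tensor_ind: x => [|x y IHx IHy|a b]; first by rewrite !linear0 mulr0 mul0r.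
  by rewrite !linearD /= mulrDr mulrDl IHx IHy.
by rewrite map_D1E T12_ox !oxM mul1r mulr1 rD.
Qed.

Lemma leg23_map_1DC x :
  leg23 r * map_1D D x = T23 (map_1D D x) * leg23 r.
Proof.
elim/tensor_ind: x => [|x y IHx IHy|a b]; first by rewrite !linear0 mulr0 mul0r.
  by rewrite !linearD /= mulrDr mulrDl IHx IHy.
rewrite map_1DE T23_assocV -!(tensor_assocV_morph A A A).2 !oxM.
by rewrite mul1r mulr1 rD.
Qed.

(** Transport of [leg12_map_D1C] by [T23]; [leg13_map_1DC] is likewise [leg23_map_1DC] transported
    by [T12]. *)
Lemma leg13_map_D1C x :
  leg13 r * T23 (map_D1 D x) = T23 (T12 (map_D1 D x)) * leg13 r.
Proof. by rewrite -!(T23_morph A).2 leg12_map_D1C. Qed.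

Lemma leg13_map_1DC x :
  leg13 r * T12 (map_1D D x) = T12 (T23 (map_1D D x)) * leg13 r.
Proof. by rewrite -T12_leg23 -!(T12_morph A).2 leg23_map_1DC. Qed.

End LegPermutations.

(** * The square of the antipode *)

Section QuasiTriangularTheory.
Variables (K : fieldType) (A : algType K) (H : qtqHopf_data A).
Hypothesis qH : is_quasiHopf H.

Local Notation D := (coprod H).
Local Notation eps := (counit H).
Local Notation S := (antipode H).
Local Notation alpha := (qalpha H).
Local Notation beta := (qbeta H).
Local Notation Phi := (coassoc H).
Local Notation R := (Rmx H).

Lemma coassoc_inverse : is_inverse Phi (rinv Phi).
Proof. exact/rinvP/coassoc_invertible. Qed.

Lemma coassocE a : Phi * map_1D D (D a) = map_D1 D (D a) * Phi.
Proof. by rewrite (quasi_coassociative qH) !mulrA coassoc_inverse.2 mul1r. Qed.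

Lemma actr_alphaD a : actr S alpha (D a) = eps a *: alpha.
Proof. exact: antipode_alpha. Qed.

Lemma actl_betaD a : actl S beta (D a) = eps a *: beta.
Proof. exact: antipode_beta. Qed.

(** The inner sum over R is alpha acted on by R_21, so u becomes a contraction of Phi alone. *)
Lemma drinfeld_u_form :
  drinfeld_u H = form_u S beta (actr S alpha (tensor_flip R)) Phi.
Proof.
have bil : bilinear_map (fun a b : A => S b * alpha * a).
  split=> [b|a] k x y; first by rewrite mulrDr -scalerAr.
  by rewrite linearP !mulrDl -!scalerAl.
have actE r : tensor_lift (fun a b : A => S b * alpha * a) r
              = actr S alpha (tensor_flip r).
  elim/tensor_ind: r => [|x y IHx IHy|a b].
  - by rewrite !linear0; have := tensor_lift_pi bil [::]; rewrite big_nil.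
  - have := tensor_lift_linear bil 1 x y; rewrite !scale1r => ->.
    by rewrite !linearD /= IHx IHy.
  by rewrite (tensor_liftE bil) tensor_flipE actrE.
rewrite /drinfeld_u /form_u -actE /tensor_lift3 /tensor_lift.
apply: eq_bigr => p _; apply: eq_bigr => q _.
by rewrite mulr_sumr mulr_suml; apply: eq_bigr => r _; rewrite !mulrA.
Qed.

Lemma twist_gamma_form :
  twist_gamma H
  = form_gamma S alpha alpha (leg123 (rinv Phi) * map_D11 D Phi).
Proof. by []. Qed.

Lemma drinfeld_twist_form :
  drinfeld_twist H = form_twist S D (twist_gamma H) beta Phi.
Proof. by []. Qed.

Let SM : forall a b, S (a * b) = S b * S a := (antipode_antialg qH).2.

(** The two flips cancel, so the square of [antipode21] is S^2 (x) S^2 and each leg of [x] passes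
    through its own [g]. *)
Lemma antipode21_sqr g x :
    (forall a, S (S a) * g = g * a) ->
  antipode21 S (antipode21 S x) * (g \ox g) = (g \ox g) * x.
Proof.
move=> gS; elim/tensor_ind: x => [|x y IHx IHy|a b].
- by rewrite !linear0 mul0r mulr0.
- by rewrite !linearD /= mulrDl mulrDr IHx IHy.
by rewrite !antipode21E !oxM !gS.
Qed.

(** The analogue of [actr_alphaD] for gamma. The iterated coproduct, entering on the right of the
    fourfold tensor, is carried to the left through (D (x) 1 (x) 1)Phi and Phi^-1 (x) 1 by
    quasi-coassociativity. There its inner legs contract with the first alpha, and the counit leaves
    [D a] to contract with the second. *)
Lemma twist_gamma_coprod a :
  actr (antipode21 S) (twist_gamma H) (tensor_map D D (D a))
  = eps a *: twist_gamma H.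
Proof.
rewrite twist_gamma_form -form_gamma_assocV // -map_11D_map_D1 -map_D11_map_1D.
rewrite -mulrA -(map_D11_morph (coprod_alg qH)).2 coassocE.
rewrite (map_D11_morph (coprod_alg qH)).2 mulrA.
rewrite (leg123_coassV coassoc_inverse coassocE) -mulrA.
rewrite (form_gamma_map_1D1 SM _ _ _ actr_alphaD).
by rewrite (map_1e1_map_D1 _ (counitr qH)) actr_alphaD form_gammaZr.
Qed.

Hypothesis tH : is_quasitriangular H.

Let c := actr S alpha (tensor_flip R).

(** Passing the flipped coproduct through R_21 turns it into [D a], which then acts on alpha
    directly. *)
Lemma drinfeld_u_contract a : actr S c (tensor_flip (D a)) = eps a *: c.
Proof.
rewrite /c -actrM // -(tensor_flip_morph A A).2 -(Rmx_coprod tH).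
rewrite (tensor_flip_morph A A).2 actrM //.
by rewrite tensor_flipK actr_alphaD actrZ.
Qed.

(** Both sides evaluate the contraction at the two members of quasi-coassociativity for [a]: to the
    left of Phi the coproduct yields S^2(a), to the right it yields [a]. *)
Lemma antipode_sqr a : S (S a) * drinfeld_u H = drinfeld_u H * a.
Proof.
rewrite drinfeld_u_form -{1}[a](counitl qH).
rewrite -(form_u_map_D1 SM _ _ _ drinfeld_u_contract) -coassocE.
by rewrite (form_u_map_1D SM _ _ _ actl_betaD) (counitr qH).
Qed.

End QuasiTriangularTheory.

(** * The twisted structure *)

Section TwistedStructure.
Variables (K : fieldType) (A : algType K) (H : qtqHopf_data A) (F : tensor2 A).
Hypothesis qH : is_quasiHopf H.
Hypothesis tF : is_twistor H F.

Local Notation D := (coprod H).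
Local Notation eps := (counit H).
Local Notation S := (antipode H).
Local Notation alpha := (qalpha H).
Local Notation beta := (qbeta H).
Local Notation Phi := (coassoc H).
Local Notation R := (Rmx H).
Local Notation F' := (rinv F).
Local Notation HF := (twist H F).

Let S1 : S 1 = 1 := (antipode_antialg qH).1.
Let SM : forall a b, S (a * b) = S b * S a := (antipode_antialg qH).2.
Let D_morph : monoid_morphism D := coprod_alg qH.
Let eps_morph : monoid_morphism eps := counit_alg qH.

Lemma twistor_inverse : is_inverse F F'.
Proof. by case: tF => /rinvP. Qed.

Lemma map_e1_twistor : map_e1 eps F = 1. Proof. by case: tF. Qed.
Lemma map_1e_twistor : map_1e eps F = 1. Proof. by case: tF. Qed.

Lemma map_e1_twistorV : map_e1 eps F' = 1.
Proof.
have [e1 _] := is_inverse_morph (map_e1_morph eps_morph) twistor_inverse.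
by rewrite -e1 map_e1_twistor mulr1.
Qed.

Lemma map_1e_twistorV : map_1e eps F' = 1.
Proof.
have [e1 _] := is_inverse_morph (map_1e_morph eps_morph) twistor_inverse.
by rewrite -e1 map_1e_twistor mulr1.
Qed.

Lemma twist_alphaK : actr S (qalpha HF) F = alpha.
Proof.
have -> : qalpha HF = actr S alpha F' by [].
by rewrite -actrM // twistor_inverse.1 actr1.
Qed.

Lemma twist_betaK : actl S (qbeta HF) F' = beta.
Proof.
have -> : qbeta HF = actl S beta F by [].
by rewrite -actlM // twistor_inverse.1 actl1.
Qed.

Lemma twist_coprodE a : coprod HF a = F * D a * F'.
Proof. by []. Qed.

Lemma twist_map_D1 x :
  map_D1 (coprod HF) x = leg12 F * map_D1 D x * leg12 F'.
Proof.
elim/tensor_ind: x => [|x y IHx IHy|a b]; first by rewrite !linear0 mulr0 mul0r.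
  by rewrite !linearD /= mulrDr mulrDl IHx IHy.
by rewrite !map_D1E !oxM mul1r mulr1.
Qed.

Lemma twist_map_1D x :
  map_1D (coprod HF) x = leg23 F * map_1D D x * leg23 F'.
Proof.
elim/tensor_ind: x => [|x y IHx IHy|a b]; first by rewrite !linear0 mulr0 mul0r.
  by rewrite !linearD /= mulrDr mulrDl IHx IHy.
by rewrite !map_1DE -!(tensor_assocV_morph A A A).2 !oxM mul1r mulr1.
Qed.

Lemma twist_map_D11 t :
  map_D11 (coprod HF) t = leg123 (leg12 F) * map_D11 D t * leg123 (leg12 F').
Proof.
elim/tensor_ind: t => [|x y IHx IHy|a b]; first by rewrite !linear0 mulr0 mul0r.
  by rewrite !linearD /= mulrDr mulrDl IHx IHy.
by rewrite !map_D11E twist_map_D1 !oxM mul1r mulr1.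
Qed.

Lemma twist_map_1D1 t :
  map_1D1 (coprod HF) t = leg123 (leg23 F) * map_1D1 D t * leg123 (leg23 F').
Proof.
elim/tensor_ind: t => [|x y IHx IHy|a b]; first by rewrite !linear0 mulr0 mul0r.
  by rewrite !linearD /= mulrDr mulrDl IHx IHy.
by rewrite !map_1D1E twist_map_1D !oxM mul1r mulr1.
Qed.

Lemma twist_map_11D t :
  map_11D (coprod HF) t = leg234 (leg23 F) * map_11D D t * leg234 (leg23 F').
Proof.
elim/tensor_ind: t => [|x y IHx IHy|a b]; first by rewrite !linear0 mulr0 mul0r.
  by rewrite !linearD /= mulrDr mulrDl IHx IHy.
rewrite !map_11DE !leg234_leg23 -!(tensor_assocV_morph (tensor2 A) A A).2 !oxM.
by rewrite mul1r mulr1.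
Qed.

Let leg12K := is_inverse_morph (@leg12_morph K A) twistor_inverse.
Let leg23K := is_inverse_morph (@leg23_morph K A) twistor_inverse.
Let map_D1K := is_inverse_morph (map_D1_morph D_morph) twistor_inverse.
Let map_1DK := is_inverse_morph (map_1D_morph D_morph) twistor_inverse.

(** The inverse of Phi_F, factor by factor in reverse order, replacing the choice made by [rinv]. *)
Definition twist_coassocV : tensor3 A :=
  leg23 F * map_1D D F * rinv Phi * map_D1 D F' * leg12 F'.

Lemma twist_coassoc_inverse : is_inverse (coassoc HF) twist_coassocV.
Proof.
have := is_inverseM (is_inverseM (is_inverseM (is_inverseM leg12K map_D1K)
  (coassoc_inverse qH)) (is_inverseC map_1DK)) (is_inverseC leg23K).
by rewrite !mulrA.
Qed.

Lemma rinv_twist_coassoc : rinv (coassoc HF) = twist_coassocV.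
Proof. exact: rinvE twist_coassoc_inverse. Qed.

Lemma twist_quasi_coassociative a :
  map_1D (coprod HF) (coprod HF a)
  = rinv (coassoc HF) * map_D1 (coprod HF) (coprod HF a) * coassoc HF.
Proof.
rewrite rinv_twist_coassoc twist_map_1D twist_map_D1 twist_coprodE.
rewrite !(map_1D_morph D_morph).2 !(map_D1_morph D_morph).2 quasi_coassociative //.
rewrite /twist_coassocV /= !mulrA.
rewrite (is_inverseK (is_inverseC leg12K)) (is_inverseK (is_inverseC leg12K)).
by rewrite !(is_inverseK (is_inverseC map_D1K)).
Qed.

Lemma twist_pentagon :
  map_D11 (coprod HF) (coassoc HF) * map_11D (coprod HF) (coassoc HF)
  = leg123 (coassoc HF) * map_1D1 (coprod HF) (coassoc HF) * leg234 (coassoc HF).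
Proof.
rewrite twist_map_D11 twist_map_1D1 twist_map_11D /=.
rewrite !(map_D11_morph D_morph).2 !(map_1D1_morph D_morph).2.
rewrite !(map_11D_morph D_morph).2 !(@leg123_morph K A).2 !(@leg234_morph K A).2.
rewrite !map_D11_leg12 !map_11D_leg12 // !map_1D1_leg12 !map_D11_leg23 //.
rewrite !map_11D_leg23 !map_1D1_leg23 !leg234_leg12 !map_D11_map_1D.
apply: pentagon_word.
- exact: is_inverse_morph (@leg123_morph K A) leg12K.
- exact: is_inverse_morph (@leg123_morph K A) leg23K.
- exact: is_inverse_morph (@leg234_morph K A) leg23K.
- exact: is_inverse_morph (@leg123_morph K A) map_1DK.
- exact: is_inverse_morph (@leg234_morph K A) map_D1K.
- exact: is_inverse_morph (map_11D_morph D_morph) map_D1K.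
(* Legs 12 and 34 are disjoint: bracketed in pairs, the two elements are F^-1 (x) 1 and 1 (x) F. *)
- rewrite leg123_leg12 leg234_leg23 -!(tensor_assocV_morph (tensor2 A) A A).2.
  by rewrite !oxM !mul1r !mulr1.
- exact/leg123_coass/coassocE.
- exact/leg234_coass/coassocE.
- exact: pentagon.
Qed.

Lemma twist_is_quasiHopf : is_quasiHopf HF.
Proof.
have [_ FF'] := twistor_inverse.
have betaD := actl_betaD qH.
have alphaD := actr_alphaD qH.
split.
- exact: counit_alg qH.
- split=> [|a b]; first by rewrite twist_coprodE D_morph.1 mulr1.
  rewrite !twist_coprodE D_morph.2 !mulrA.
  by rewrite (is_inverseK (is_inverseC twistor_inverse)).
- exact: antipode_antialg qH.
- exact: is_inverse_invertible twist_coassoc_inverse.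
- exact: twist_quasi_coassociative.
- exact: twist_pentagon.
- move=> a; rewrite twist_coprodE !(map_e1_morph eps_morph).2 (counitl qH).
  by rewrite map_e1_twistor map_e1_twistorV mul1r mulr1.
- move=> a; rewrite twist_coprodE !(map_1e_morph eps_morph).2 (counitr qH).
  by rewrite map_1e_twistor map_1e_twistorV mul1r mulr1.
(* The counit on the middle leg sends both outer factors of Phi_F to 1 and strips the coproducts
   from the inner ones, leaving F F^-1. *)
- rewrite /= !(map_1e1_morph eps_morph).2 (counit_coassoc qH) mulr1 map_1e1E.
  rewrite (map_1e1_map_D1 _ (counitr qH)) (map_1e1_map_1D _ (counitl qH)).
  by rewrite map_1e1_leg23 map_1e_twistor map_e1_twistorV ox11 mul1r mulr1 FF'.
(* The left factor of D_F(a) restores alpha, [D a] then acts by [eps a], and the right factor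
   rebuilds alpha_F. *)
- move=> a; change (actr S (qalpha HF) (coprod HF a) = eps a *: qalpha HF).
  by rewrite twist_coprodE !actrM // twist_alphaK alphaD actrZ.
- move=> a; change (actl S (qbeta HF) (coprod HF a) = eps a *: qbeta HF).
  by rewrite twist_coprodE !actlM // twist_betaK betaD actlZ.
(* The outer factors of Phi_F^-1 turn beta_F and alpha_F back into beta and alpha; only then do the
   inner coproduct factors contract to 1. *)
- change (form_ba S (qbeta HF) (qalpha HF) (rinv (coassoc HF)) = 1).
  rewrite rinv_twist_coassoc /twist_coassocV form_ba_leg12 // -!mulrA.
  rewrite form_ba_leg23 // twist_betaK twist_alphaK.
  rewrite (form_ba_map_1D SM _ _ _ alphaD) (form_ba_map_D1 SM _ _ _ betaD).
  by rewrite map_1e_twistor map_e1_twistorV mul1r mulr1; exact: antipode_coassocV.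
change (form_ab S (qalpha HF) (qbeta HF) (coassoc HF) = 1).
rewrite [coassoc _]/= form_ab_leg23 // -!mulrA form_ab_leg12 //.
rewrite twist_alphaK twist_betaK (form_ab_map_D1 SM _ _ _ alphaD).
rewrite (form_ab_map_1D SM _ _ _ betaD) map_e1_twistor map_1e_twistorV S1.
by rewrite mul1r mulr1; exact: antipode_coassoc.
Qed.

Hypothesis tH : is_quasitriangular H.

Lemma twist_is_quasitriangular : is_quasitriangular HF.
Proof.
have flipK := is_inverse_morph (@tensor_flip_morph K A A) twistor_inverse.
have DD := map_D1_morph D_morph.
have DD' := map_1D_morph D_morph.
have RD := Rmx_coprod tH.
split.
- case: (Rmx_invertible tH) => R' RR'.
  have := is_inverseM (is_inverseM flipK RR') (is_inverseC twistor_inverse).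
  exact: is_inverse_invertible.
- move=> a; rewrite !twist_coprodE !(@tensor_flip_morph K A A).2 /= !mulrA.
  rewrite (is_inverseK (is_inverseC flipK)).
  rewrite -[_ * tensor_flip (D a) * R]mulrA RD !mulrA.
  by rewrite (is_inverseK (is_inverseC twistor_inverse)).
- rewrite twist_map_D1 rinv_twist_coassoc /twist_coassocV /=.
  rewrite !DD.2 (hexagon_D1 tH) !(@leg13_morph K A).2 !(@leg23_morph K A).2.
  rewrite !(@T12_morph K A).2 !(@T23_morph K A).2 T12_leg23 T23_leg13.
  (* The permutation 231 turns (1 (x) D)F into (D (x) 1)F_21, the first factor of (D (x) 1)R_F; in
     the other hexagon 312 matches (D (x) 1)F with (1 (x) D)F_21. *)
  rewrite T231_map_1D T12_leg12 T23_leg23.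
  apply: hexagon_word.
  + exact: is_inverse_morph (@T23_morph K A)
      (is_inverse_morph (@T12_morph K A) map_D1K).
  + exact: is_inverse_morph (@leg13_morph K A) flipK.
  + exact: is_inverse_morph (@leg13_morph K A) twistor_inverse.
  + exact: is_inverse_morph (@T23_morph K A) map_1DK.
  + exact: is_inverse_morph (@leg23_morph K A) flipK.
  + exact: leg23K.
  + exact: leg13_map_D1C.
  + exact: leg23_map_1DC.
rewrite twist_map_1D rinv_twist_coassoc /twist_coassocV /=.
rewrite !DD'.2 (hexagon_1D tH) !(@leg13_morph K A).2 !(@leg12_morph K A).2.
rewrite !(@T23_morph K A).2 !(@T12_morph K A).2 T23_leg23 !T12_leg23 T12_leg13.
rewrite T312_map_D1 T12_leg12.
apply: hexagon_word.
- exact: is_inverse_morph (@T12_morph K A)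
    (is_inverse_morph (@T23_morph K A) map_1DK).
- exact: is_inverse_morph (@leg13_morph K A) flipK.
- exact: is_inverse_morph (@leg13_morph K A) twistor_inverse.
- exact: is_inverse_morph (@T12_morph K A) map_D1K.
- exact: is_inverse_morph (@leg12_morph K A) flipK.
- exact: leg12K.
- exact: leg13_map_1DC.
- exact: leg12_map_D1C.
Qed.

End TwistedStructure.

(** * The elements u, gamma, the Drinfeld twist and v under twisting *)

Section TwistedRibbon.
Variables (K : fieldType) (A : algType K) (H : qtqHopf_data A) (F : tensor2 A).
Hypothesis qH : is_quasiHopf H.
Hypothesis tH : is_quasitriangular H.
Hypothesis tF : is_twistor H F.

Local Notation D := (coprod H).
Local Notation S := (antipode H).
Local Notation Phi := (coassoc H).
Local Notation F' := (rinv F).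
Local Notation HF := (twist H F).
Local Notation s := (antipode21 S).

Let S1 : S 1 = 1 := (antipode_antialg qH).1.
Let SM : forall a b, S (a * b) = S b * S a := (antipode_antialg qH).2.
Let D_morph : monoid_morphism D := coprod_alg qH.
Let FK : is_inverse F F' := twistor_inverse tF.

Lemma twist_drinfeld_u : drinfeld_u HF = drinfeld_u H.
Proof.
rewrite !drinfeld_u_form [antipode HF]/= [coassoc HF]/= [Rmx HF]/=.
rewrite form_u_leg23 // (twist_betaK qH tF) (form_u_map_1D SM _ _ _ (actl_betaD qH)).
(* The factor F^-1 of R_F cancels F_12 of Phi_F, and F_21, flipped, turns alpha_F back into
   alpha. *)
rewrite map_1e_twistorV // mulr1 -!mulrA form_u_leg12 // -actrM //.
rewrite -(@tensor_flip_morph K A A).2 -!mulrA FK.1 mulr1.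
rewrite (@tensor_flip_morph K A A).2 actrM //.
rewrite tensor_flipK (twist_alphaK qH tF).
rewrite (form_u_map_D1 SM _ _ _ (drinfeld_u_contract qH tH)).
by rewrite map_e1_twistor // !S1 mul1r.
Qed.

(** The factors to the left of Phi^-1 (x) 1 cancel or contract with the two alphas. On the right,
    F^-1 on legs 12 and 34 combines to F^-1 (x) F^-1, giving the outer factors, while (D (x) D)F^-1
    stays. *)
Lemma twist_twist_gamma :
  twist_gamma HF
  = s F' * actr s (twist_gamma H) (tensor_map D D F') * F'.
Proof.
have D11 := map_D11_morph D_morph.
have leg123K := is_inverse_morph (@leg123_morph K A)
  (is_inverse_morph (@leg12_morph K A) FK).
have D1K := is_inverse_morph (@leg123_morph K A)
  (is_inverse_morph (map_D1_morph D_morph) FK).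
rewrite twist_gamma_form twist_map_D11 [coassoc HF]/= !D11.2.
rewrite map_D11_leg12 map_D11_leg23 // map_D11_map_1D map_11D_map_D1.
rewrite (rinv_twist_coassoc qH tF) /twist_coassocV !(@leg123_morph K A).2 !mulrA.
rewrite (is_inverseK (is_inverseC leg123K)) (is_inverseK (is_inverseC D1K)).
rewrite -[_ * leg123 (rinv Phi) * _]mulrA.
rewrite (leg123_coassV (coassoc_inverse qH) (coassocE qH)) -!mulrA.
rewrite form_gamma_leg23 // (twist_alphaK qH tF) -map_1D1_leg12.
rewrite (form_gamma_map_1D1 SM _ _ _ (actr_alphaD qH)) map_1e1E.
rewrite (map_1e_twistor tF) ox11 actr1 //.
rewrite (form_gamma_map_1D1 SM _ _ _ (actr_alphaD qH)).
rewrite (map_1e1_map_D1 _ (counitr qH)) (twist_alphaK qH tF).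
rewrite leg123_leg12 leg234_leg23 -(tensor_assocV_morph (tensor2 A) A A).2 oxM.
rewrite mul1r mulr1 !mulrA !form_gamma_assocV // (actrE _ _ F' F').
by rewrite twist_gamma_form.
Qed.

(** Each D_F is a conjugation by F: its outer halves do not depend on the summation and factor out,
    its inner halves are absorbed into [g]. *)
Lemma twist_form_twist g b t :
  form_twist S (coprod HF) g b t = s F' * form_twist S D (s F * g * F) b t * F'.
Proof.
elim/tensor3_ind: t => [|x y IHx IHy|x y z].
- by rewrite !linear0 mulr0 mul0r.
- by rewrite !linearD /= IHx IHy mulrDr mulrDl.
by rewrite !form_twistE !twist_coprodE !(antipode21M SM) !mulrA.
Qed.

Lemma twist_drinfeld_twist :
  drinfeld_twist HF = s F' * drinfeld_twist H * F'.
Proof.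
have sM : forall x y, s (x * y) = s y * s x := antipode21M SM.
have [_ sFK] := antipode21_inverse S1 SM FK.
rewrite drinfeld_twist_form [antipode HF]/= twist_form_twist twist_twist_gamma.
rewrite !mulrA sFK mul1r -[_ * F' * F]mulrA FK.1 mulr1; congr (_ * _ * _).
rewrite [coassoc HF]/= form_twist_leg23 // (twist_betaK qH tF).
rewrite (form_twist_map_1D SM _ _ _ _ (actl_betaD qH)) //.
rewrite map_1e_twistorV // D_morph.1 antipode21_1 // mul1r -!mulrA.
(* F_12 of Phi_F acts on gamma as (D (x) D)F and cancels the (D (x) D)F^-1 left by
   [twist_twist_gamma]. *)
rewrite form_twist_leg12 // -actrM // -(tensor_map_morph D_morph D_morph).2.
rewrite FK.1 (tensor_map_morph D_morph D_morph).1 actr1; last exact: antipode21_1.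
rewrite (form_twist_map_D1 SM _ _ _ _ (twist_gamma_coprod qH)) //.
by rewrite map_e1_twistor // S1 D_morph.1 mulr1.
Qed.

Lemma twist_ribbon_element v : is_ribbon_element H v -> is_ribbon_element HF v.
Proof.
move=> [vC v2 Sv ev Dg]; rewrite /is_ribbon_element twist_drinfeld_u.
split=> //; set g := drinfeld_u H * rinv v.
have sFK := antipode21_inverse S1 SM FK.
(* u intertwines S^2 with the identity, and [rinv v] commutes with [a] because [v] is central. *)
have gS a : S (S a) * g = g * a.
  rewrite mulrA antipode_sqr // -!mulrA; congr (_ * _); exact/esym/rinv_comm.
rewrite twist_coprodE Dg twist_drinfeld_twist.
(* The inverse ends in [s F], which meets and cancels the [s F'] that opens the image under [s];
   what remains at the end is [s (s F')], to be carried through g (x) g. *)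
rewrite (rinv_mul3 _ (is_inverseC sFK) (is_inverseC FK)).
have sE x : tensor_map S S (tensor_flip x) = s x by [].
rewrite [antipode HF]/= !sE -/g !(antipode21M SM) -!mulrA; congr (_ * (_ * _)).
by rewrite [RHS]mulrA sFK.2 mul1r antipode21_sqr.
Qed.

End TwistedRibbon.

Theorem proposition1 (K : fieldType) (A : algType K) (H : qtqHopf_data A)
    (F : tensor2 A) :
  is_ribbon H -> is_twistor H F -> is_ribbon (twist H F).
Proof.
move=> [qH tH [v rv]] tF; split.
- exact: twist_is_quasiHopf.
- exact: twist_is_quasitriangular.
- by exists v; exact: twist_ribbon_element.
Qed.
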